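(* Let $H_1$ and $H_2$ be selfadjoint relations in a separable Hilbert space $\mathfrak H$ which are bounded from below and have closed ranges. Let $\mathsf i(H_j)=\{\mathsf i_j^+,\mathsf i_j^-,\mathsf i_j^0,\mathsf i_j^\infty\}$ be the inertia of $H_j$, $j=1,2$. Assume that $\mathsf i_1^-+\mathsf i_1^0<\infty$ and that $H_1\le H_2$. Then $$-H_1^{-1}\le -H_2^{-1}\quad\text{if and only if}\quad \mathsf i_1^-+\mathsf i_1^0=\mathsf i_2^-+\mathsf i_2^0 .$$
   Context: A (linear) relation $H$ in a Hilbert space $\mathfrak H$ is a linear subspace of $\mathfrak H\times\mathfrak H$. Put $\operatorname{dom}H=\{h:\{h,k\}\in H\}$, $\operatorname{ran}H=\{k:\{h,k\}\in H\}$, $\ker H=\{h:\{h,0\}\in H\}$, $\operatorname{mul}H=\{k:\{0,k\}\in H\}$. Further $H^{-1}=\{\{k,h\}:\{h,k\}\in H\}$, $-H=\{\{h,-k\}:\{h,k\}\in H\}$, $H-\lambda=\{\{h,k-\lambda h\}:\{h,k\}\in H\}$, and $H^*=\{\{h,k\}:(g,h)=(f,k)\text{ for all }\{f,g\}\in H\}$; $H$ is selfadjoint if $H=H^*$. A selfadjoint relation $H$ decomposes orthogonally as $H=H_s\,\widehat\oplus\,(\{0\}\times\operatorname{mul}H)$ with respect to $\mathfrak H=\overline{\operatorname{dom}}H\oplus\operatorname{mul}H$, where $H_s=H\cap(\overline{\operatorname{dom}}H\times\overline{\operatorname{dom}}H)$ (the operator part) is a selfadjoint operator in $\overline{\operatorname{dom}}H$.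 The spectral measure of $H$ is $E(\cdot)=E_s(\cdot)\oplus 0_{\operatorname{mul}H}$, where $E_s$ is the spectral measure of $H_s$ on $\mathbb R$. $H$ is bounded from below by $m\in\mathbb R$ if $(H_sh,h)\ge m(h,h)$ for all $h\in\operatorname{dom}H$; the supremum of all such $m$ is the lower bound of $H$. Ordering: for selfadjoint relations $H_1,H_2$ with lower bounds $m_1,m_2$, $H_1\le H_2$ means that for some fixed $x<\min\{m_1,m_2\}$ (equivalently, for all such $x$) $0\le((H_2-x)^{-1}h,h)\le((H_1-x)^{-1}h,h)$ for all $h\in\mathfrak H$ (these resolvents are bounded everywhere defined operators). Inertia (for separable $\mathfrak H$): $\mathsf i(H)=\{\mathsf i^+(H),\mathsf i^-(H),\mathsf i^0(H),\mathsf i^\infty(H)\}$, an ordered quadruplet with $\mathsf i^+(H)=\dim\operatorname{ran}E((0,\infty))$, $\mathsf i^-(H)=\dim\operatorname{ran}E((-\infty,0))$, $\mathsf i^0(H)=\dim\ker H$, $\mathsf i^\infty(H)=\dim\operatorname{mul}H$, each in $\{0,1,2,\dots\}\cup\{\infty\}$. Inverses are taken in the sense of relations. Since the ranges are closed, the operator parts of $H_1^{-1},H_2^{-1}$ are bounded, so $-H_1^{-1}$ and $-H_2^{-1}$ are bounded from below and the ordering makes sense. *)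

(* Defs.v *)
From HB Require Import structures.
From mathcomp Require Import all_boot all_order all_algebra.
From mathcomp Require Import all_classical all_reals all_analysis.
From mathcomp Require Import complex.
Set Implicit Arguments.
Unset Strict Implicit.
Unset Printing Implicit Defensive.

Import Order.TTheory GRing.Theory Num.Theory numFieldNormedType.Exports.
Local Open Scope classical_set_scope.
Local Open Scope ring_scope.
Local Open Scope complex_scope.

(* A complex Hilbert space is a complete normed space V over R[i] whose norm
   comes from a positive definite hermitian form, linear in its first argument
   and conjugate-linear in its second one. *)
Definition hilbert_form (R : realType) (V : completeNormedModType R[i])
    (dotp : {dot V for Num.conj}) : Prop :=
  forall v : V, `|v| ^+ 2 = dotp v v.

Definition separable_space (T : topologicalType) : Prop :=
  exists2 D : set T, countable D & dense D.

Section Dimension.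
Variables (K : fieldType) (V : lmodType K).

Definition linearly_independent (n : nat) (v : 'I_n -> V) : Prop :=
  forall c : 'I_n -> K, \sum_(i < n) c i *: v i = 0 -> forall i, c i = 0.

End Dimension.

(* The dimension of a subspace W, in {0, 1, 2, ...} with +oo added; all
   infinite dimensions are identified, as is done in a separable space. *)
Definition dimension (R : realType) (V : lmodType R[i]) (W : set V) : \bar R :=
  ereal_sup [set (n%:R)%:E | n in [set n : nat |
    exists2 v : 'I_n -> V, (forall i, W (v i)) & linearly_independent v]].

(* A linear relation in V is a subset of V * V that is a linear subspace. *)
Section Relations.
Variables (R : realType) (V : completeNormedModType R[i]).
Variable dotp : {dot V for Num.conj}.
Implicit Types H : set (V * V).

Local Notation "''[' u , v ]" := (dotp u v).

Definition linear_relation H : Prop := submod_closed (mem H).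

Definition domain_of H : set V := [set h | exists k, H (h, k)].
Definition range_of H : set V := [set k | exists h, H (h, k)].
Definition kernel_of H : set V := [set h | H (h, 0)].
Definition mulpart H : set V := [set k | H (0, k)].

Definition inverse H : set (V * V) := [set (p.2, p.1) | p in H].
Definition opposite H : set (V * V) := [set (p.1, - p.2) | p in H].
Definition shift_by H (a : R[i]) : set (V * V) :=
  [set (p.1, p.2 - a *: p.1) | p in H].

Definition adjoint H : set (V * V) :=
  [set p | forall q, H q -> '[q.2, p.1] = '[q.1, p.2]].

Definition selfadjoint H : Prop := linear_relation H /\ H = adjoint H.

Definition operator_part H : set (V * V) :=
  H `&` (closure (domain_of H) `*` closure (domain_of H)).

(* In R[i], a <= b means that b - a is a nonnegative real number. *)
Definition bounded_from_below_by H (m : R) : Prop :=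
  forall h k, operator_part H (h, k) -> m%:C * '[h, h] <= '[k, h].

Definition bounded_from_below H : Prop :=
  exists m : R, bounded_from_below_by H m.

(* This is +oo when the domain of H is {0}. *)
Definition lower_bound H : \bar R :=
  ereal_sup [set m%:E | m in bounded_from_below_by H].

(* For selfadjoint H and x below the lower bound of H, this is the graph of a
   bounded everywhere defined operator. *)
Definition resolvent H (x : R) : set (V * V) := inverse (shift_by H x%:C).

Definition relation_le H1 H2 : Prop :=
  exists2 x : R,
    (x%:E < mine (lower_bound H1) (lower_bound H2))%E
  & forall h : V, exists k1 k2 : V,
      [/\ resolvent H1 x (h, k1), resolvent H2 x (h, k2)
        & 0 <= '[k2, h] <= '[k1, h]].

Definition orthogonal_projection (P : V -> V) : Prop :=
  [/\ linear P, P \o P = P & forall u v, '[P u, v] = '[u, P v]].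

(* mu h is the scalar measure A |-> (E(A) h, h); that it is a measure for every
   h is equivalent to the strong countable additivity of E. Values of E and of
   mu h at sets that are not Borel are irrelevant. *)
Definition projection_valued_measure (E : set (measurableTypeR R) -> V -> V)
    (mu : V -> {measure set (measurableTypeR R) -> \bar R}) : Prop :=
  [/\ forall A, measurable A -> orthogonal_projection (E A),
      forall A B, measurable A -> measurable B -> E (A `&` B) = E A \o E B
    & forall h A, measurable A -> mu h A = (complex.Re '[E A h, h])%:E].

(* The conditions say that E restricted to the closure of the domain of H is
   the spectral measure of the operator part H_s, and that E vanishes on the
   orthogonal complement mul H of that closure: E(R) is the projection onto it,
   and H_s is the integral of t with respect to E, that is, dom H_s consists of
   the h with t^2 integrable, and (H_s h, h) is the integral of t, for the
   measure (E(.) h, h). By polarization this determines H_s. *)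
Definition spectral_measure_of H (E : set (measurableTypeR R) -> V -> V)
    (mu : V -> {measure set (measurableTypeR R) -> \bar R}) : Prop :=
  [/\ projection_valued_measure E mu,
      range (E setT) = closure (domain_of H),
      domain_of H = [set h | closure (domain_of H) h /\
                          (\int[mu h]_t (t ^+ 2)%:E < +oo)%E]
    & forall h k, operator_part H (h, k) ->
        '[k, h] = (Rintegral (mu h) setT (fun t => t))%:C].

End Relations.

Record inertia (R : realType) := Inertia {
  ipos : \bar R;
  ineg : \bar R;
  izero : \bar R;
  iinfty : \bar R }.

(* The spectral measure of a selfadjoint relation exists and is unique, so that
   this is the graph of a function of H. *)
Definition is_inertia (R : realType) (V : completeNormedModType R[i])
    (dotp : {dot V for Num.conj}) (H : set (V * V)) (i : inertia R) : Prop :=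
  exists E mu, spectral_measure_of dotp H E mu /\
    i = Inertia (dimension (range (E `]0, +oo[%classic)))
                (dimension (range (E `]-oo, 0[%classic)))
                (dimension (kernel_of H))
                (dimension (mulpart H)).

(* Main.v *)
Require Import Defs.
From HB Require Import structures.
From mathcomp Require Import all_boot all_order all_algebra.
From mathcomp Require Import all_classical all_reals all_analysis.
From mathcomp Require Import complex.
From mathcomp Require Import measurable_realfun ring lra.
Set Implicit Arguments.
Unset Strict Implicit.
Unset Printing Implicit Defensive.
Import Order.TTheory GRing.Theory Num.Theory numFieldNormedType.Exports.
Local Open Scope classical_set_scope.
Local Open Scope ring_scope.
Local Open Scope complex_scope.

(* Let x be below the lower bounds of H1 and H2, R_j = (H_j - x)^-1, and let
   s > 0 be so small that neither relation has spectrum in (0, s]. With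
   y = -1/s, the resolvent (-H_j^-1 - y)^-1 is s + s^2 (H_j - s)^-1. The bounded
   operator A_j = (H_j - s)(H_j - x)^-1 = 1 - (s - x) R_j has the inverse
   1 + (s - x) (H_j - s)^-1, so that H1 <= H2 means A1 <= A2, and
   -H1^-1 <= -H2^-1 means A2^-1 <= A1^-1. Moreover, i_j^- + i_j^0 is the largest
   dimension n_j of a subspace on which A_j is negative: such subspaces
   correspond to subspaces of dom H_j on which H_j - s is negative.

   If A2^-1 <= A1^-1, then A1 <= A2 gives n_2 <= n_1, and the reverse inequality
   follows from n_-(A) = n_-(A^-1). Conversely, the form
   <A2 f, f> + 2 Re <f, g> + <A1^-1 g, g> on pairs (f, g) is congruent both to
   A2 (+) (A1^-1 - A2^-1) and to A1^-1 (+) (A2 - A1). Hence, if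
   <A1^-1 v, v> < <A2^-1 v, v> for some v, an n-dimensional negative subspace
   of A2 produces an (n + 1)-dimensional one of A1, and n_1 > n_2. *)

(** * Real inner product and completeness *)

Section RealInnerProduct.
Variables (R : realType) (V : completeNormedModType R[i]).
Variable dotp : {dot V for Num.conj}.

(** Taking real parts keeps all inequalities in [R]; [dotp_ip] recovers the complex form through
    multiplication by ['i]. *)
Definition rdot (u v : V) : R := complex.Re (dotp u v).
Local Notation ip := rdot.

Lemma dotpC u v : dotp u v = (dotp v u)^*.
Proof. by rewrite hermC expr0 mul1r. Qed.

Lemma dotpZl a u v : dotp (a *: u) v = a * dotp u v.
Proof. by rewrite linearZl_LR. Qed.

Lemma ipC u v : ip u v = ip v u.
Proof. by rewrite /rdot dotpC; case: (dotp v u). Qed.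

Lemma ipDl u v w : ip (u + v) w = ip u w + ip v w.
Proof. by rewrite /rdot linearDl raddfD. Qed.

Lemma ipNl u w : ip (- u) w = - ip u w.
Proof. by rewrite /rdot linearNl raddfN. Qed.

Lemma ipDr u v w : ip u (v + w) = ip u v + ip u w.
Proof. by rewrite ipC ipDl !(ipC u). Qed.

Lemma ipNr u w : ip u (- w) = - ip u w.
Proof. by rewrite ipC ipNl ipC. Qed.

Lemma ip0l u : ip 0 u = 0.
Proof. by rewrite /rdot linear0l. Qed.

Lemma ip0r u : ip u 0 = 0.
Proof. by rewrite ipC ip0l. Qed.

Lemma ipZl (a : R) u v : ip (a%:C *: u) v = a * ip u v.
Proof.
by rewrite /rdot dotpZl; case: (dotp u v) => x y /=; rewrite mul0r subr0.
Qed.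

Lemma ipZr (a : R) u v : ip u (a%:C *: v) = a * ip u v.
Proof. by rewrite ipC ipZl ipC. Qed.

Lemma ipiZ u v : ip ('i *: u) v = - complex.Im (dotp u v).
Proof.
by rewrite /rdot dotpZl; case: (dotp u v) => x y /=; rewrite mul0r mul1r sub0r.
Qed.

Lemma ipii u v : ip ('i *: u) ('i *: v) = ip u v.
Proof.
rewrite ipiZ dotpC dotpZl dotpC /rdot; case: (dotp u v) => x y /=.
by rewrite mul0r mul1r add0r opprK.
Qed.

Lemma dotp_ip u v : dotp u v = (ip u v +i* - ip ('i *: u) v)%C.
Proof. by rewrite ipiZ opprK /rdot; case: (dotp u v). Qed.

Definition ipE := (ipDl, ipDr, ipNl, ipNr, ipZl, ipZr, ip0l, ip0r).

Lemma dotpp u : dotp u u = (ip u u)%:C.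
Proof.
have := dnorm_ge0 dotp u; rewrite /rdot; case: (dotp u u) => x y /=.
by rewrite lecE/= => /andP[/eqP -> _].
Qed.

Lemma ip_ge0 u : 0 <= ip u u.
Proof. by have := dnorm_ge0 dotp u; rewrite dotpp lecR. Qed.

Lemma ip_eq0 u : ip u u = 0 -> u = 0.
Proof. by move=> u0; apply/eqP; rewrite -(dnorm_eq0 dotp) dotpp u0. Qed.

Lemma ip_gt0 u : u != 0 -> 0 < ip u u.
Proof.
by move=> u0; rewrite lt_def ip_ge0 andbT; apply: contra u0 => /eqP/ip_eq0 ->.
Qed.

Lemma ipZZ (a : R[i]) u v :
  ip (a *: u) (a *: v) = complex.Re (a * a^*) * ip u v.
Proof.
rewrite /rdot dotpZl dotpC dotpZl dotpC; case: (dotp u v) => x y.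
by case: a => b c /=; ring.
Qed.

(** The square of |v|^2 u - <u, v> v is |v|^2 times the difference of the two sides. *)
Lemma cauchy_schwarz u v : ip u v ^+ 2 <= ip u u * ip v v.
Proof.
have [->|v0] := eqVneq v 0; first by rewrite !ip0r mulr0 expr0n.
have := ip_ge0 ((ip v v)%:C *: u - (ip u v)%:C *: v).
rewrite !ipE (ipC v u) => h.
have vp := ip_gt0 v0; rewrite -subr_ge0 -(pmulr_rge0 _ vp).
by apply: le_trans h _; rewrite le_eqVlt; apply/orP; left; apply/eqP; ring.
Qed.

(** The norm of [V] has values in [R[i]]; this one has values in [R], and [normE] identifies the
    two. *)
Definition hnorm u : R := Num.sqrt (ip u u).
Local Notation nr := hnorm.

Lemma nr_ge0 u : 0 <= nr u. Proof. exact: sqrtr_ge0. Qed.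

Lemma nr2 u : nr u ^+ 2 = ip u u. Proof. by rewrite sqr_sqrtr// ip_ge0. Qed.

Lemma nr_eq0 u : nr u = 0 -> u = 0.
Proof. by move=> u0; apply: ip_eq0; rewrite -nr2 u0 expr0n. Qed.

Lemma nr0 : nr 0 = 0. Proof. by rewrite /hnorm ip0l sqrtr0. Qed.

Lemma nrN u : nr (- u) = nr u.
Proof. by rewrite /hnorm !ipE opprK. Qed.

Lemma nrB u v : nr (u - v) = nr (v - u).
Proof. by rewrite -nrN opprB. Qed.

Lemma nrZ a u : nr (a%:C *: u) = `|a| * nr u.
Proof.
by rewrite /hnorm !ipE mulrA -expr2 sqrtrM ?sqr_ge0// sqrtr_sqr.
Qed.

Lemma ip_le_nr u v : `|ip u v| <= nr u * nr v.
Proof.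
rewrite -ler_sqr ?nnegrE ?mulr_ge0 ?nr_ge0//.
by rewrite exprMn !nr2 real_normK ?num_real// cauchy_schwarz.
Qed.

Lemma nrD u v : nr (u + v) <= nr u + nr v.
Proof.
rewrite -ler_sqr ?nnegrE ?addr_ge0 ?nr_ge0// sqrrD !nr2 !ipE (ipC v u).
have := le_trans (ler_norm _) (ip_le_nr u v); lra.
Qed.

Lemma ler_nrD w u v : nr (u - v) <= nr (u - w) + nr (w - v).
Proof. by rewrite (le_trans _ (nrD _ _))// addrA subrK. Qed.

Hypothesis hilbertV : hilbert_form dotp.

Lemma normE u : `|u| = (nr u)%:C.
Proof.
apply/eqP; rewrite -(@eqrXn2 _ 2)//; last by rewrite lecR nr_ge0.
by rewrite hilbertV dotpp -nr2 rmorphXn.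
Qed.

Lemma closureP (A : set V) v :
  closure A v <-> forall e : R, 0 < e -> exists2 w, A w & nr (v - w) < e.
Proof.
split=> [cl e e0|h B /nbhs_ballP[e/= e0 Be]].
  have e0' : 0 < e%:C :> R[i] by rewrite ltcR.
  have [w [Aw]] := cl _ (nbhsx_ballx v _ e0').
  by rewrite -ball_normE/= normE ltcR; exists w.
have : 0 < complex.Re e by move: e0; rewrite ltcE/= => /andP[].
move=> /h[w Aw ew]; exists w; split=> //; apply: Be.
rewrite -ball_normE/= normE ltcE/= ew andbT.
by move: e0; rewrite ltcE/= => /andP[].
Qed.

Lemma hilbert_complete (u : nat -> V) :
  (forall e : R, 0 < e -> exists N : nat, forall m n,
     (N <= m)%N -> (N <= n)%N -> nr (u m - u n) < e) ->
  exists l, forall e : R, 0 < e -> exists N : nat, forall n,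
     (N <= n)%N -> nr (u n - l) < e.
Proof.
move=> cau.
have : cvg (u n @[n --> \oo]).
  apply/cauchy_cvgP/cauchy_ballP => e e0; near_simpl.
  have e1 : 0 < complex.Re e by move: (e0); rewrite ltcE/= => /andP[].
  have ee : e = (complex.Re e)%:C.
    by move: (e0); case: e {e0 e1} => a b; rewrite ltcE/= => /andP[/eqP -> _].
  have [N HN] := cau _ e1.
  exists ([set n | N <= n]%N, [set n | N <= n]%N); first by split; exists N.
  move=> [m n] [/= Nm Nn]; rewrite -ball_normE/= normE ee ltcR.
  exact: HN.
move=> /cvg_ex[l /cvgrPdist_lt ul]; exists l => e e0.
have e0' : 0 < e%:C :> R[i] by rewrite ltcR.
have [N _ HN] := ul _ e0'; exists N => n Nn.
by have := HN n Nn; rewrite /= normE ltcR nrB.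
Qed.

End RealInnerProduct.

(** * Projection theorem *)

Lemma eq0_small (R : realType) (K x : R) :
  (forall e, 0 < e -> `|x| <= K * e) -> x = 0.
Proof.
move=> h; apply/eqP; rewrite -normr_le0; apply/ler_addgt0Pr => e e0.
(* Nothing is known about the sign of [K]; the divisor |K| + 1 is positive in every case. *)
rewrite add0r; have K1 : 0 < `|K| + 1 by rewrite ltr_wpDl.
apply: le_trans (h (e / (`|K| + 1)) _) _; first by rewrite divr_gt0.
rewrite mulrA ler_pdivrMr// mulrC ler_pM2l//.
by rewrite (le_trans (ler_norm _))// lerDl.
Qed.

Lemma eventually_invS_lt (R : realType) (e : R) : 0 < e ->
  exists N : nat, forall n, (N <= n)%N -> n.+1%:R^-1 < e.
Proof.
move=> e0; exists (Num.truncn e^-1) => n Nn.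
rewrite -[ltRHS]invrK ltf_pV2 ?posrE ?invr_gt0//.
by apply: lt_le_trans (truncnS_gt _) _; rewrite ler_nat ltnS.
Qed.

Section Hilbert.
Variables (R : realType) (V : completeNormedModType R[i]).
Variable dotp : {dot V for Num.conj}.
Hypothesis hilbertV : hilbert_form dotp.
Local Notation ip := (rdot dotp).
Local Notation nr := (hnorm dotp).

Definition subspace (M : set V) : Prop :=
  M 0 /\ forall (a : R[i]) u v, M u -> M v -> M (a *: u + v).

Lemma subspaceD M u v : subspace M -> M u -> M v -> M (u + v).
Proof. by move=> [_ h] ? ?; rewrite -[u]scale1r; apply: h. Qed.

Lemma subspaceZ M a u : subspace M -> M u -> M (a *: u).
Proof. by move=> [h0 h] ?; rewrite -[_ *: _]addr0; apply: h. Qed.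

Lemma ip_closure0 (M : set V) u v :
  (forall m, M m -> ip u m = 0) -> closure M v -> ip u v = 0.
Proof.
move=> uM /(closureP hilbertV) clv; apply: (@eq0_small _ (nr u)) => e /clv[w Mw].
move=> vw; have -> : ip u v = ip u (v - w) by rewrite !ipE (uM w)// oppr0 addr0.
by apply: le_trans (ip_le_nr _ _ _) _; rewrite ler_wpM2l ?nr_ge0 ?ltW.
Qed.

Lemma subspace_closure (M : set V) : subspace M -> subspace (closure M).
Proof.
move=> [M0 MD]; split; first exact: subset_closure.
move=> a u v /(closureP hilbertV) clu /(closureP hilbertV) clv.
apply/(closureP hilbertV) => e e0.
(* The square root is |a|, and the added 1 covers a = 0. *)
have a0 : 0 < Num.sqrt (complex.Re (a * a^*)) + 1.
  by rewrite ltr_wpDl ?sqrtr_ge0.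
have [u' Mu' uu'] := clu (e / (Num.sqrt (complex.Re (a * a^*)) + 1) / 2)
                       (divr_gt0 (divr_gt0 e0 a0) (ltr0n _ 2)).
have [v' Mv' vv'] := clv (e / 2) (divr_gt0 e0 (ltr0n _ 2)).
exists (a *: u' + v'); first exact: MD.
have -> : a *: u + v - (a *: u' + v') = a *: (u - u') + (v - v').
  by rewrite scalerBr opprD addrACA.
apply: le_lt_trans (nrD _ _ _) _.
rewrite [ltRHS](splitr e) ler_ltD// {1}/hnorm ipZZ sqrtrM; last first.
  by case: (a) => b c /=; rewrite mulrN opprK addr_ge0// -expr2 sqr_ge0.
move: uu'; rewrite mulrAC ltr_pdivlMr// => /ltW; apply: le_trans.
by rewrite mulrC ler_wpM2l ?nr_ge0// lerDl.
Qed.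

(** A minimizing sequence is Cauchy by the parallelogram law, and a vector of [M] not orthogonal to
    the error would improve the limit. Since [M] is a complex subspace, orthogonality for [rdot] is
    orthogonality for [dotp]. *)
Lemma projection_theorem (M : set V) v : subspace M -> closed M ->
  exists2 w, M w & forall m, M m -> ip (v - w) m = 0.
Proof.
move=> sM clM; pose D := [set nr (v - m) | m in M]; pose d := inf D.
have hD : has_inf D.
  by split; [exists (nr (v - 0)), 0; case: sM|exists 0 => _ [m _ <-]; exact: nr_ge0].
have dle m : M m -> d <= nr (v - m) by move=> Mm; apply: ge_inf (hD.2) _ _; exists m.
have d0 : 0 <= d by apply: lb_le_inf (hD.1) _ => _ [m _ <-]; exact: nr_ge0.
have /choice[w wP] (n : nat) : exists w, M w /\ nr (v - w) < d + n.+1%:R^-1.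
  have n0 : 0 < n.+1%:R^-1 :> R by rewrite invr_gt0.
  by have [_ [m Mm <-] dm] := inf_adherent n0 hD; exists m.
have cau (e : R) : 0 < e -> exists N : nat, forall m n,
     (N <= m)%N -> (N <= n)%N -> nr (w m - w n) < e.
  (* If both distances are below d + e1, the parallelogram law bounds the squared gap by 4 (d +
     e1)^2 - 4 d^2 = 8 d e1 + 4 e1^2, which is at most e1 (8 d + 5) because e1 <= 1. *)
  move=> e0; pose e1 := Num.min 1 (e ^+ 2 / (8 * d + 5)).
  have d5 : 0 < 8 * d + 5 by lra.
  have e10 : 0 < e1 by rewrite lt_min ltr01 divr_gt0// exprn_gt0.
  have [N HN] := eventually_invS_lt e10; exists N => m n Nm Nn.
  rewrite -ltr_sqr ?nnegrE ?nr_ge0 ?ltW// nr2.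
  have [Mm /lt_trans-/(_ (d + e1))] := wP m; rewrite ltrD2l => /(_ (HN _ Nm)) hm.
  have [Mn /lt_trans-/(_ (d + e1))] := wP n; rewrite ltrD2l => /(_ (HN _ Nn)) hn.
  have h2 : M ((2^-1)%:C *: (w m + w n)).
    by apply: subspaceZ => //; apply: subspaceD.
  have := dle _ h2; rewrite -ler_sqr ?nnegrE ?nr_ge0//. rewrite nr2.
  have sqd x : 0 <= x -> x < d + e1 -> x ^+ 2 < (d + e1) ^+ 2.
    by move=> x0 xd; rewrite ltr_sqr ?nnegrE// addr_ge0// ltW.
  move: hm hn => /(sqd _ (nr_ge0 _ _)) hm /(sqd _ (nr_ge0 _ _)).
  move: hm; rewrite !nr2 !ipE => hm hn h.
  have e11 : e1 <= 1 by rewrite ge_min lexx.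
  have : e1 * (8 * d + 5) <= e ^+ 2.
    by rewrite -ler_pdivlMr// ge_min lexx orbT.
  rewrite !(ipC dotp _ v) (ipC dotp (w n) (w m)) in h hm hn *.
  have : e1 * e1 <= e1 by rewrite ger_pMr.
  lra.
have [l lP] := hilbert_complete hilbertV cau.
have Ml : M l.
  apply: clM; apply/(closureP hilbertV) => e /lP[N /(_ N (leqnn N))].
  by rewrite nrB; exists (w N) => //; case: (wP N).
have ld : nr (v - l) <= d.
  apply/ler_addgt0Pr => e e0; have e2 : 0 < e / 2 by rewrite divr_gt0.
  have [N1 H1] := lP _ e2; have [N2 H2] := eventually_invS_lt e2.
  have := H1 _ (leq_maxl N1 N2); have := H2 _ (leq_maxr N1 N2).
  move: (maxn N1 N2) => n; have [_] := wP n; have := ler_nrD dotp (w n) v l.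
  move: (_^-1) => ?; lra.
exists l => // m Mm; apply/eqP/negPn/negP => p0.
have h (t : R) : ip (v - l) (v - l) <= ip (v - l - t%:C *: m) (v - l - t%:C *: m).
  rewrite -!nr2 ler_sqr ?nnegrE ?nr_ge0// (le_trans ld)// -addrA -opprD.
  by apply: dle; apply: subspaceD => //; apply: subspaceZ.
have m0 : 0 < ip m m.
  by apply: ip_gt0; apply: contraNneq p0 => ->; rewrite ip0r.
move: (v - l) h p0 => u h p0.
(* For this [t] the squared norm of u - t m is that of u minus t <u, m>, which is smaller. *)
have := h (ip u m / ip m m); set t := _ / _.
have tm : t * ip m m = ip u m by rewrite divfK// gt_eqF.
have : 0 < t * ip u m.
  by rewrite /t mulrAC -expr2 divr_gt0// exprn_even_gt0.
rewrite !ipE (ipC _ m u) tm; lra.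
Qed.

End Hilbert.

(** * Selfadjoint relations and their resolvents *)

Section UniformBoundedness.
Variables (R : realType) (V : completeNormedModType R[i]).
Variable dotp : {dot V for Num.conj}.
Hypothesis hilbertV : hilbert_form dotp.
Local Notation ip := (rdot dotp).
Local Notation nr := (hnorm dotp).

(* Gliding hump: if k n is in F with a large enough norm, then moving x n by
   3^-(n+1) in the direction of k n, with the right sign, makes the inner
   product with k n large; the later moves are too small to undo this. *)
Lemma weakly_bounded (F : set V) :
  (forall v, exists M : R, forall k, F k -> `|ip v k| <= M) ->
  exists C : R, forall k, F k -> nr k <= C.
Proof.
move=> Fw; apply: contrapT => /forallNP nF.
have /choice[k kP] (n : nat) :
    exists k, F k /\ 2 * n%:R * 3 ^+ n.+1 + 1 < nr k.
  have /existsNP[k /not_implyP[Fk /negP]] := nF (2 * n%:R * 3 ^+ n.+1 + 1).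
  by rewrite -ltNge; exists k.
have nk0 n : 0 < nr (k n).
  by apply: le_lt_trans (kP n).2; rewrite addr_ge0// !mulr_ge0// exprn_ge0.
pose r n : R := 3 ^- n.+1.
have r0 n : 0 < r n by rewrite invr_gt0 exprn_gt0.
pose e n := (r n / nr (k n))%:C *: k n.
have ne n : nr (e n) = r n.
  by rewrite /e nrZ ger0_norm ?divr_ge0 ?nr_ge0 ?ltW// divfK// gt_eqF.
pose step n x :=
  if r n * nr (k n) <= `|ip (x + e n) (k n)| then x + e n else x - e n.
pose x := fix x n := if n is m.+1 then step m (x m) else 0.
have xk n : r n * nr (k n) <= `|ip (x n.+1) (k n)|.
  rewrite /= /step; case: ifPn => //; rewrite -ltNge !ipE.
  have -> : r n / nr (k n) * ip (k n) (k n) = r n * nr (k n).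
    by rewrite -nr2 expr2 mulrA divfK// gt_eqF.
  rewrite ltr_norml => /andP[_ h].
  rewrite ler0_norm; last by have := mulr_gt0 (r0 n) (nk0 n); lra.
  by lra.
have xS n : nr (x n.+1 - x n) = r n.
  rewrite /= /step; case: ifPn => _.
    by rewrite addrC addKr ne.
  by rewrite addrC addKr nrN ne.
have xD n j : nr (x (n + j)%N - x n) <= (3 ^- n - 3 ^- (n + j)) / 2.
  elim: j => [|j ih]; first by rewrite addn0 !subrr nr0 mul0r.
  rewrite addnS (le_trans (ler_nrD _ (x (n + j)%N) _ _))// xS.
  rewrite -lerBrDl (le_trans ih)//.
  have : r (n + j)%N * 3 = 3 ^- (n + j).
    by rewrite /r exprSr invfM divfK// pnatr_eq0.
  rewrite -/(r (n + j)%N); lra.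
have p3 (n : nat) : 0 < (3 ^- n : R) by rewrite invr_gt0 exprn_gt0.
have n3 (n : nat) : (3 ^- n : R) <= n.+1%:R^-1.
  rewrite lef_pV2 ?posrE ?exprn_gt0//.
  elim: n => [|n ih]; first by rewrite expr0.
  rewrite exprS -[n.+2]addn1 natrD; have : 1 <= (n.+1%:R : R) by rewrite ler1n.
  by lra.
have cau (d : R) : 0 < d -> exists N : nat, forall m n,
     (N <= m)%N -> (N <= n)%N -> nr (x m - x n) < d.
  move=> d0; have [N HN] := eventually_invS_lt d0; exists N => m n Nm Nn.
  rewrite (le_lt_trans _ (HN N _))// (le_trans (ler_nrD _ (x N) _ _))//.
  have := xD N (m - N)%N; have := xD N (n - N)%N; rewrite !subnKC//.
  rewrite [nr (x n - _)]nrB; have := n3 N; have := p3 n; have := p3 m.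
  move: (3 ^- n) (3 ^- m) (3 ^- N) (N.+1%:R^-1) => a b c d'; lra.
have [l lP] := hilbert_complete hilbertV cau.
have xl n : nr (l - x n.+1) <= r n / 2.
  apply/ler_addgt0Pr => d /lP[N HN].
  have := HN _ (leq_addl n.+1 N); have := xD n.+1 N.
  have := ler_nrD dotp (x (n.+1 + N)%N) l (x n.+1).
  rewrite (nrB _ l (x (n.+1 + N)%N)) -/(r n).
  by have := p3 (n.+1 + N)%N; move: (3 ^- _) => ?; lra.
(* All moves after the one in direction [k n] add up to at most half of its length, so at least half
   of [r n * nr (k n)] survives in the limit, and this exceeds [n]. *)
have big n : n%:R <= `|ip l (k n)|.
  have : r n * nr (k n) <= `|ip l (k n)| + r n / 2 * nr (k n).
    apply: le_trans (xk n) _; rewrite -lerBlDl.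
    apply: le_trans (lerB_dist _ _) _.
    rewrite -ipNl -ipDl (le_trans (ip_le_nr _ _ _))// ler_wpM2r ?nr_ge0//.
    by rewrite nrB.
  have : r n * (2 * n%:R * 3 ^+ n.+1 + 1) < r n * nr (k n).
    by rewrite ltr_pM2l// (kP n).2.
  have : r n * 3 ^+ n.+1 = 1 by rewrite mulVf// expf_neq0.
  move: (3 ^+ n.+1) (r0 n) => t rn tr.
  have -> : r n * (2 * n%:R * t + 1) = 2 * n%:R * (r n * t) + r n by ring.
  rewrite tr; lra.
have [M MP] := Fw l; have := le_trans (big (Num.truncn M).+1) (MP _ (kP _).1).
by rewrite leNgt truncnS_gt.
Qed.

End UniformBoundedness.

(** * Operator part, resolvents and closed range of a selfadjoint relation *)

Section Selfadjoint.
Variables (R : realType) (V : completeNormedModType R[i]).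
Variable dotp : {dot V for Num.conj}.
Hypothesis hilbertV : hilbert_form dotp.
Local Notation ip := (rdot dotp).
Local Notation nr := (hnorm dotp).

(** The graph of [G] is only required to lie in (H - a)^-1; for selfadjoint [H], [resolventE] shows
    that it is all of it, and linearity and symmetry follow. *)
Definition has_resolvent (H : set (V * V)) (a : R) (G : V -> V) :=
  forall g, H (G g, g + a%:C *: G g).

Definition form_lower_bound (H : set (V * V)) (m : R) :=
  forall h k, H (h, k) -> m * ip h h <= ip k h.

Section OneRelation.
Variable H : set (V * V).
Hypothesis saH : selfadjoint dotp H.

Lemma rel_lin a h k f g : H (h, k) -> H (f, g) -> H (a *: h + f, a *: k + g).
Proof.
by have [[_ /(_ a (h, k) (f, g))]] := saH; rewrite !in_setE => h1 _; exact: h1.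
Qed.

Lemma rel0 : H (0, 0).
Proof. by have [[]] := saH; rewrite in_setE. Qed.

Lemma relZ a h k : H (h, k) -> H (a *: h, a *: k).
Proof. by move=> /(rel_lin a)/(_ rel0); rewrite !addr0. Qed.

Lemma relD h k f g : H (h, k) -> H (f, g) -> H (h + f, k + g).
Proof. by move=> /(rel_lin 1); rewrite !scale1r; apply. Qed.

Lemma relB h k f g : H (h, k) -> H (f, g) -> H (h - f, k - g).
Proof. by move=> hk /(relZ (-1)); rewrite !scaleN1r; exact: relD. Qed.

Lemma rel_sum n (c : 'I_n -> R[i]) (h k : 'I_n -> V) :
  (forall i, H (h i, k i)) -> H (\sum_i c i *: h i, \sum_i c i *: k i).
Proof.
move=> hk; elim/big_ind2: _ => //; first exact: rel0.
  by move=> *; exact: relD.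
by move=> i _; exact: relZ.
Qed.

(** Real parts suffice to test membership in the adjoint, because [H] is stable under multiplication
    by ['i]. *)
Lemma relP h k : H (h, k) <-> forall f g, H (f, g) -> ip g h = ip f k.
Proof.
split=> [|hk].
  by rewrite {1}saH.2 => hk f g /hk /= e; rewrite /rdot e.
rewrite saH.2 => -[f g] /= fg; rewrite !(dotp_ip dotp); congr (_ +i* - _)%C.
  exact: hk.
by apply: hk; exact: relZ.
Qed.

Lemma rel_sym h k f g : H (h, k) -> H (f, g) -> ip g h = ip f k.
Proof. by move=> /relP; apply. Qed.

Lemma rel_domain : subspace (domain_of H).
Proof.
split; first by exists 0; exact: rel0.
by move=> a u v [k hk] [l hl]; exists (a *: k + l); exact: rel_lin.
Qed.

Lemma rel_range : subspace (range_of H).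
Proof.
split; first by exists 0; exact: rel0.
by move=> a u v [k hk] [l hl]; exists (a *: k + l); exact: rel_lin.
Qed.

(** Project [k] onto the closure of the domain: the error is orthogonal to the domain, hence in the
    multivalued part, and does not contribute to <k, h>. *)
Lemma operator_part_of h k : H (h, k) ->
  exists2 k', operator_part H (h, k') & ip k' h = ip k h.
Proof.
move=> hk; pose M := closure (domain_of H).
have sM : subspace M by apply: subspace_closure => //; exact: rel_domain.
have [k' Mk' kk'] := projection_theorem hilbertV k sM (@closed_closure _ _).
have domM f g : H (f, g) -> M f by move=> fg; apply: subset_closure; exists g.
have : H (0, k - k').
  by apply/relP => f g fg; rewrite ip0r ipC kk'//; exact: domM fg.
move=> /(relB hk); rewrite subr0 opprB addrC subrK => hk'.
exists k'; first by split=> //; split=> //=; exact: domM hk.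
by apply/eqP; rewrite eq_sym -subr_eq0 -ipNl -ipDl kk'//; exact: domM hk.
Qed.

(** By [operator_part_of] the bound extends to all pairs of [H]. Symmetry of [H] on (h, k) and its
    multiple by ['i] makes <k, h> real. *)
Lemma lower_bound_form m : bounded_from_below_by dotp H m <-> form_lower_bound H m.
Proof.
split=> [hm h k /operator_part_of[k' /hm + <-]|hm h k [hk _]].
  rewrite dotpp -rmorphM/= (dotp_ip _ k') lecE/= => /andP[_].
  by rewrite /rdot.
rewrite dotpp -rmorphM/= dotp_ip lecE/= hm// andbT oppr_eq0.
have := rel_sym hk (relZ 'i hk); rewrite !ipiZ (dotpC _ k h).
by case: (dotp h k) => a b /= e; apply/eqP; lra.
Qed.

(** The difference p = h - G g satisfies (p, a p) in [H]; symmetry against the pair (G p, p + a G p)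
    leaves <p, p> = 0. *)
Lemma resolventE a G : has_resolvent H a G ->
  forall h k, H (h, k) -> h = G (k - a%:C *: h).
Proof.
move=> hG h k hk; set g := k - _; apply/eqP; rewrite -subr_eq0; apply/eqP.
have := relB hk (hG g); set p := h - G g => hp.
have {}hp : H (p, a%:C *: p).
  by move: hp; rewrite /g opprD addrA opprB addrCA subrr addr0 -scalerBr.
apply: (@ip_eq0 _ _ dotp); have := rel_sym hp (hG p).
by rewrite !ipE => /eqP; rewrite -subr_eq0 addrK => /eqP.
Qed.

Lemma resolvent_lin a G : has_resolvent H a G ->
  forall (c : R[i]) u v, G (c *: u + v) = c *: G u + G v.
Proof.
move=> hG c u v; have := resolventE hG (rel_lin c (hG u) (hG v)).
move=> ->; congr (G _); rewrite !scalerDr !scalerA (mulrC c).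
by rewrite addrACA addrK.
Qed.

Lemma resolvent_sym a G : has_resolvent H a G ->
  forall u v, ip (G u) v = ip u (G v).
Proof.
move=> hG u v; have := rel_sym (hG u) (hG v); rewrite !ipE.
by rewrite (ipC _ v) (ipC _ (G v) u); lra.
Qed.

(** The estimate makes the range [M] of H - a closed. A vector p orthogonal to it has (p, a p) in
    H^* = H, so the estimate gives p = 0 and the range is everything. *)
Lemma resolvent_exists a (d : R) : 0 < d ->
  (forall h k, H (h, k) -> d * nr h <= nr (k - a%:C *: h)) ->
  exists G, has_resolvent H a G.
Proof.
move=> d0 hd; pose M := [set g | exists h, H (h, g + a%:C *: h)].
have sM : subspace M.
  split; first by exists 0; rewrite scaler0 addr0; exact: rel0.
  move=> c u v [h hu] [f fv]; exists (c *: h + f).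
  have := rel_lin c hu fv; congr H; congr pair.
  by rewrite !scalerDr !scalerA (mulrC c) addrACA.
have clM : closed M.
  move=> g /(closureP hilbertV) clg.
  have /choice[w wP] (n : nat) : exists w : V * V,
      H (w.1, w.2 + a%:C *: w.1) /\ nr (g - w.2) < n.+1%:R^-1.
    have [|w [h hw] gw] := clg (n.+1%:R^-1); first by rewrite invr_gt0.
    by exists (h, w).
  have cau (e : R) : 0 < e -> exists N : nat, forall m n,
      (N <= m)%N -> (N <= n)%N -> nr ((w m).1 - (w n).1) < e.
    move=> e0; have [|N HN] := @eventually_invS_lt _ (d * e / 2).
      by rewrite divr_gt0// mulr_gt0.
    exists N => m n Nm Nn; rewrite -(ltr_pM2l d0).
    apply: le_lt_trans (hd _ _ (relB (wP m).1 (wP n).1)) _.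
    rewrite scalerBr opprD addrACA addrK.
    apply: le_lt_trans (ler_nrD _ g _ _) _; rewrite [ltRHS]splitr nrB ltrD//.
      exact: lt_trans (wP m).2 (HN _ Nm).
    exact: lt_trans (wP n).2 (HN _ Nn).
  have [h hP] := hilbert_complete hilbertV cau.
  exists h; apply/relP => f l fl; apply/eqP; rewrite -subr_eq0; apply/eqP.
  apply: (@eq0_small _ (nr (l - a%:C *: f) + nr f)) => e e0.
  have [N1 H1] := hP _ e0; have [N2 H2] := eventually_invS_lt e0.
  have := H1 _ (leq_maxl N1 N2); have := H2 _ (leq_maxr N1 N2).
  move: (maxn _ _) => n n2 /ltW n1; have /ltW n3 := lt_trans (wP n).2 n2.
  have -> : ip l h - ip f (g + a%:C *: h) =
     - ip (l - a%:C *: f) ((w n).1 - h) - ip f (g - (w n).2).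
    by have := rel_sym (wP n).1 fl; rewrite !ipE; lra.
  rewrite mulrDl (le_trans (ler_normB _ _))// normrN.
  by rewrite lerD// (le_trans (ip_le_nr _ _ _))// ler_wpM2l ?nr_ge0.
suff : forall g, M g by move=> /choice[G GP]; exists G.
move=> g; have [w Mw gw] := projection_theorem hilbertV g sM clM.
suff : g - w = 0 by move/eqP; rewrite subr_eq0 => /eqP ->.
apply: (@nr_eq0 _ _ dotp); have : H (g - w, a%:C *: (g - w)).
  apply/relP => f l fl; have /gw : M (l - a%:C *: f) by exists f; rewrite subrK.
  by rewrite ipC !ipE; lra.
move=> /hd; rewrite subrr nr0 pmulr_rle0// => h; apply/eqP.
by rewrite eq_le h nr_ge0.
Qed.

(** This is boundedness of the operator part of H^-1. The set [F] is weakly bounded: replacing [v]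
    by its projection w onto the range, with (u, w) in [H], gives <v, h> = <u, k>. *)
Lemma closed_range_bound : closed (range_of H) -> exists2 C : R, 0 < C &
  forall h k, H (h, k) -> range_of H h -> nr h <= C * nr k.
Proof.
move=> clR; pose F := [set h | range_of H h /\ exists2 k, H (h, k) & nr k <= 1].
have [|C CP] := @weakly_bounded _ _ dotp hilbertV F.
  move=> v; have [w [u uw] vw] := projection_theorem hilbertV v rel_range clR.
  exists (nr u) => h [Rh [k hk k1]].
  have -> : ip v h = ip w h by apply/eqP; rewrite -subr_eq0 -ipNl -ipDl vw.
  rewrite (rel_sym hk uw) (le_trans (ip_le_nr _ _ _))//.
  by rewrite ler_piMr// nr_ge0.
exists (`|C| + 1) => [|h k hk Rh]; first by rewrite ltr_wpDl.
(* Normalizing is impossible when k = 0; then h lies in both kernel and range, which are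
   orthogonal. *)
have [k0|k0] := eqVneq (nr k) 0.
  have [u uh] := Rh; have := rel_sym hk uh; rewrite (nr_eq0 k0) ip0r => /ip_eq0 ->.
  by rewrite !nr0 mulr0.
have kp : 0 < nr k by rewrite lt_def k0 nr_ge0.
have : F ((nr k)^-1%:C *: h).
  split; first exact: subspaceZ rel_range Rh.
  exists ((nr k)^-1%:C *: k); first exact: relZ.
  by rewrite nrZ ger0_norm ?invr_ge0 ?nr_ge0// mulVf.
move=> /CP; rewrite nrZ ger0_norm ?invr_ge0 ?nr_ge0// ler_pdivrMl// mulrC.
move=> /le_trans; apply; rewrite ler_wpM2r ?nr_ge0//.
by rewrite (le_trans (ler_norm _))// lerDl.
Qed.

End OneRelation.
End Selfadjoint.

(** * Dimensions *)

Definition join_families T p q (a : 'I_p -> T) (b : 'I_q -> T) (i : 'I_(p + q)) :=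
  match fintype.split i with inl j => a j | inr j => b j end.

Lemma join_familiesl T p q (a : 'I_p -> T) (b : 'I_q -> T) j :
  join_families a b (lshift q j) = a j.
Proof. by rewrite /join_families (unsplitK (inl j)). Qed.

Lemma join_familiesr T p q (a : 'I_p -> T) (b : 'I_q -> T) j :
  join_families a b (rshift p j) = b j.
Proof. by rewrite /join_families (unsplitK (inr j)). Qed.

Section LinearAlgebra.
Variables (K : fieldType) (V : lmodType K).

(** With k < n, the n by k matrix of coordinates has a nonzero left kernel vector, which is a linear
    relation among the [p i]. *)
Lemma independent_span_leq n k (p : 'I_n -> V) (u : 'I_k -> V) :
  linearly_independent p ->
  (forall i, exists c : 'I_k -> K, p i = \sum_j c j *: u j) -> (n <= k)%N.
Proof.
move=> indp /choice[c pc]; rewrite leqNgt; apply/negP => kn.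
pose M := \matrix_(i < n, j < k) c i j.
have /rowV0Pn[x /sub_kermxP xM /eqP] : kermx M != 0.
  rewrite -mxrank_eq0 mxrank_ker subn_eq0 -ltnNge.
  exact: leq_ltn_trans (rank_leq_col M) kn.
apply; apply/rowP => i; rewrite mxE; apply: (indp (fun i => x 0 i)).
under eq_bigr => i0 _ do rewrite pc scaler_sumr.
rewrite exchange_big big1// => j _.
under eq_bigr do rewrite scalerA.
rewrite -scaler_suml (_ : \sum_i _ = 0) ?scale0r//.
have /rowP/(_ j) := xM; rewrite !mxE; apply: etrans.
by apply: eq_bigr => i0 _; rewrite mxE.
Qed.

Definition with_head n (w : V) (v : 'I_n -> V) (i : 'I_n.+1) :=
  if unlift ord0 i is Some j then v j else w.

Lemma sum_with_head n (c : 'I_n.+1 -> K) w (v : 'I_n -> V) :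
  \sum_i c i *: with_head w v i =
  c ord0 *: w + \sum_j c (lift ord0 j) *: v j.
Proof.
rewrite big_ord_recl /with_head unlift_none; congr (_ + _).
by apply: eq_bigr => j _; rewrite liftK.
Qed.

(** In a nontrivial relation the coefficient of [w] cannot vanish, so one can solve for [w]. *)
Lemma maximal_independent_span n (v : 'I_n -> V) w :
  linearly_independent v -> ~ linearly_independent (with_head w v) ->
  exists c : 'I_n -> K, w = \sum_j c j *: v j.
Proof.
move=> indv /existsNP[c /not_implyP[c0 /existsNP[i ci]]].
rewrite sum_with_head in c0.
have t0 : c ord0 != 0.
  apply/eqP => t0; rewrite t0 scale0r add0r in c0; apply: ci.
  by case: (unliftP ord0 i) => [j ->|->//]; exact: indv c0 j.
exists (fun j => - (c (lift ord0 j) / c ord0)).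
apply: (scalerI t0); rewrite scaler_sumr; apply/eqP.
rewrite -subr_eq0 -sumrN -[X in _ == X]c0; apply/eqP; congr (_ + _).
apply: eq_bigr => j _; rewrite scalerA mulrN -scaleNr opprK mulrCA divff//.
by rewrite mulr1.
Qed.

Lemma sum_join_families p q (c : 'I_(p + q) -> K) (a : 'I_p -> V) (b : 'I_q -> V) :
  \sum_i c i *: join_families a b i =
  \sum_j c (lshift q j) *: a j + \sum_j c (rshift p j) *: b j.
Proof.
rewrite big_split_ord; congr (_ + _); apply: eq_bigr => j _.
  by rewrite join_familiesl.
by rewrite join_familiesr.
Qed.

End LinearAlgebra.

(** * Suprema of sets of natural numbers in the extended reals *)

Section NatSup.
Variable R : realType.
Implicit Types S : set nat.
Local Notation nsup S := (ereal_sup [set (n%:R)%:E | n in S] : \bar R).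

Lemma nat_sup_ge0 S : S 0%N -> (0 <= nsup S)%E.
Proof. by move=> S0; apply: ereal_sup_ubound; exists 0%N. Qed.

Lemma nat_sup_attained S : S 0%N -> (nsup S < +oo)%E ->
  exists n, [/\ S n, nsup S = n%:R%:E & forall m, S m -> (m <= n)%N].
Proof.
move=> S0 Soo.
have Sfin : nsup S \is a fin_num by rewrite ge0_fin_numE// nat_sup_ge0.
pose P n := `[< S n >].
have exP : exists n, P n by exists 0%N; exact/asboolP.
have ubP n : P n -> (n <= Num.truncn (fine (nsup S)))%N.
  move=> /asboolP Sn; rewrite truncn_ge_nat; last exact/fine_ge0/nat_sup_ge0.
  by rewrite -lee_fin fineK//; apply: ereal_sup_ubound; exists n.
have [n /asboolP Sn nP] := ex_maxnP exP ubP.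
exists n; split=> // [|m Sm]; last by apply: nP; exact/asboolP.
apply/eqP; rewrite eq_le; apply/andP; split; last by apply: ereal_sup_ubound; exists n.
apply: ge_ereal_sup => _ [m Sm <-]; rewrite lee_fin ler_nat nP//.
exact/asboolP.
Qed.

(** As 0 lies in [S1] and [S2], both are contained in [S]; if the supremum of [S] is finite, theirs
    are attained and the maxima can be added. *)
Lemma nat_supD S1 S2 S : S1 0%N -> S2 0%N ->
  (forall p q, S1 p -> S2 q -> S (p + q)%N) -> (nsup S1 + nsup S2 <= nsup S)%E.
Proof.
move=> S10 S20 S12; have [->|] := eqVneq (nsup S) +oo%E; first by rewrite leey.
rewrite -ltey => Soo.
have [|n [Sn -> _]] := nat_sup_attained S10.
  apply: le_lt_trans Soo; apply: ereal_sup_le => _ [n Sn <-]; exists n => //.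
  by rewrite -[n]addn0; exact: S12.
have [|m [Sm -> _]] := nat_sup_attained S20.
  apply: le_lt_trans Soo; apply: ereal_sup_le => _ [m Sm <-]; exists m => //.
  exact: (S12 0%N).
rewrite -EFinD -natrD; apply: ereal_sup_ubound; exists (n + m)%N => //.
exact: S12.
Qed.

End NatSup.

(** * Negative subspaces and the ordering *)

Section Ordering.
Variables (R : realType) (V : completeNormedModType R[i]).
Variable dotp : {dot V for Num.conj}.
Hypothesis hilbertV : hilbert_form dotp.
Local Notation ip := (rdot dotp).
Local Notation nr := (hnorm dotp).

Lemma form_lower_bound_le (H : set (V * V)) m m' : m' <= m ->
  form_lower_bound dotp H m -> form_lower_bound dotp H m'.
Proof.
move=> mm hm h k /hm; apply: le_trans; rewrite ler_wpM2r// ip_ge0//.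
Qed.

Lemma resolvent_form (H : set (V * V)) x m G : has_resolvent H x G ->
  form_lower_bound dotp H m -> forall g, (m - x) * ip (G g) (G g) <= ip (G g) g.
Proof.
move=> hG hm g; have := hm _ _ (hG g); rewrite !ipE (ipC _ g); lra.
Qed.

Lemma dotp_resolvent (H : set (V * V)) x G : selfadjoint dotp H ->
  has_resolvent H x G -> forall g, dotp (G g) g = (ip (G g) g)%:C.
Proof.
move=> sa hG g; rewrite dotp_ip; congr (_ +i* _)%C.
have GiZ : G ('i *: g) = 'i *: G g.
  have := resolvent_lin sa hG 'i g 0; rewrite !addr0 => ->.
  have -> : G 0 = 0; last by rewrite addr0.
  have := resolvent_lin sa hG 1 0 0; rewrite !scale1r addr0 => /eqP.
  by rewrite -subr_eq0 opprD addNKr oppr_eq0 => /eqP.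
have := resolvent_sym sa hG ('i *: g) g; rewrite GiZ -(ipii _ ('i *: g)).
rewrite scalerA -expr2 sqr_i scaleN1r !ipE (ipC _ g); lra.
Qed.

(** One strict common form bound [m] replaces the extended lower bounds. Nonnegativity of <G2 h, h>
    need not be listed: it follows from x < m by [resolvent_form]. *)
Lemma relation_leP (H1 H2 : set (V * V)) :
  selfadjoint dotp H1 -> selfadjoint dotp H2 ->
  relation_le dotp H1 H2 <-> exists x m G1 G2,
    [/\ x < m, form_lower_bound dotp H1 m /\ form_lower_bound dotp H2 m,
      has_resolvent H1 x G1, has_resolvent H2 x G2 &
      forall h, ip (G2 h) h <= ip (G1 h) h].
Proof.
move=> sa1 sa2; have resE (H : set (V * V)) x h k :
    resolvent H x (h, k) <-> H (k, h + x%:C *: k).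
  split=> [[[u v]] [[u' v'] huv [<- <-]] [<- <-]|hk].
    by rewrite subrK.
  by exists (k, h) => //; exists (k, h + x%:C *: k) => //=; rewrite addrK.
split=> [[x]|[x [m [G1 [G2 [xm [hm1 hm2] hG1 hG2 G12]]]]]].
  rewrite lt_min => /andP[].
  move=> /ereal_sup_gt[_ [m1 /(lower_bound_form hilbertV sa1) hm1 <-]].
  rewrite lte_fin => xm1.
  move=> /ereal_sup_gt[_ [m2 /(lower_bound_form hilbertV sa2) hm2 <-]].
  rewrite lte_fin => xm2.
  move=> /choice[G1] /choice[G2] hG.
  exists x, (Num.min m1 m2), G1, G2; split.
  - by rewrite lt_min xm1.
  - by split; [apply: form_lower_bound_le hm1|apply: form_lower_bound_le hm2];
      rewrite ge_min lexx ?orbT.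
  - by move=> h; apply/resE; case: (hG h).
  - by move=> h; apply/resE; case: (hG h).
  - by move=> h; have [_ _ /andP[_]] := hG h; rewrite lecE => /andP[_].
have lb (H : set (V * V)) : selfadjoint dotp H -> form_lower_bound dotp H m ->
    (x%:E < lower_bound dotp H)%E.
  move=> sa /(lower_bound_form hilbertV sa) hm.
  apply: (@lt_le_trans _ _ m%:E); first by rewrite lte_fin.
  by apply: ereal_sup_ubound; exists m.
exists x; first by rewrite lt_min !lb.
move=> h; exists (G1 h), (G2 h); split; [exact/resE/hG1|exact/resE/hG2|].
rewrite (dotp_resolvent sa1 hG1) (dotp_resolvent sa2 hG2) !lecR G12 andbT.
apply: le_trans (resolvent_form hG2 hm2 h).
by rewrite mulr_ge0 ?ip_ge0// subr_ge0 ltW.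
Qed.

Definition linear_op (A : V -> V) :=
  forall (c : R[i]) u v, A (c *: u + v) = c *: A u + A v.

Definition symmetric_op (A : V -> V) := forall u v, ip (A u) v = ip u (A v).

Lemma linear_op0 A : linear_op A -> A 0 = 0.
Proof.
move=> lA; have := lA 1 0 0; rewrite !scale1r addr0 => /eqP.
by rewrite -subr_eq0 opprD addNKr oppr_eq0 => /eqP.
Qed.

Lemma linear_opD A u v : linear_op A -> A (u + v) = A u + A v.
Proof. by move=> lA; have := lA 1 u v; rewrite !scale1r. Qed.

Lemma linear_opZ A c u : linear_op A -> A (c *: u) = c *: A u.
Proof. by move=> lA; have := lA c u 0; rewrite (linear_op0 lA) !addr0. Qed.

Lemma linear_op_sum A n (c : 'I_n -> R[i]) v : linear_op A ->
  A (\sum_i c i *: v i) = \sum_i c i *: A (v i).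
Proof.
move=> lA; elim/big_ind2: _; first exact: linear_op0.
  by move=> x1 x2 y1 y2 <- <-; rewrite linear_opD.
by move=> i _; rewrite linear_opZ.
Qed.

Definition one_plus (c : R) (G : V -> V) v := v + c%:C *: G v.

Lemma one_plus_linear c G : linear_op G -> linear_op (one_plus c G).
Proof.
move=> lG a u v; rewrite /one_plus lG !scalerDr !scalerA (mulrC a).
by rewrite addrACA.
Qed.

Lemma one_plus_symmetric c G : symmetric_op G -> symmetric_op (one_plus c G).
Proof. by move=> sG u v; rewrite /one_plus !ipE sG. Qed.

(* With R = (H - x)^-1 and G = (H - s)^-1, the operator 1 + (x - s) R is
   (H - s)(H - x)^-1, and 1 + (s - x) G is its inverse. *)
Lemma one_plus_resolventK (H : set (V * V)) x s Rx G : selfadjoint dotp H ->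
  has_resolvent H x Rx -> has_resolvent H s G ->
  cancel (one_plus (s - x) G) (one_plus (x - s) Rx).
Proof.
move=> sa hR hG g; rewrite /one_plus.
have -> : Rx (g + (s - x)%:C *: G g) = G g.
  by rewrite [RHS](resolventE sa hR (hG g)) -addrA -scalerBl -rmorphB.
by rewrite -addrA -scalerDl -rmorphD/= addrA subrK subrr scale0r addr0.
Qed.

(* The value of the form <A2 f, f> + 2 Re <f, g> + <A1^-1 g, g> at
   f = n - w, g = A1 u = A2 w is the right-hand side; completing the square with
   respect to g, it is <A1 (f + u), f + u> + <(A2 - A1) f, f>. *)
Lemma schur_bound A1 A2 n u w : linear_op A1 -> linear_op A2 ->
  symmetric_op A1 -> symmetric_op A2 ->
  (forall f, ip (A1 f) f <= ip (A2 f) f) -> A1 u = A2 w ->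
  ip (A1 (n + (u - w))) (n + (u - w)) <=
  ip (A2 n) n + (ip u (A1 u) - ip w (A1 u)).
Proof.
move=> l1 l2 s1 s2 A12 uw; have := A12 (n - w).
have AN A z : linear_op A -> A (- z) = - A z.
  by move=> lA; rewrite -scaleN1r linear_opZ// scaleN1r.
rewrite !(linear_opD _ _ l1) !(linear_opD _ _ l2) !(AN _ _ l1) !(AN _ _ l2) -uw !ipE.
have := s1 n u; have := s1 u w; have := s1 n w; have := s2 n w; rewrite -uw.
have := s2 n n; have := s1 w w; have := s1 u u; have := s1 n n; have := s2 w w.
rewrite -uw !(ipC _ _ (A1 _)) !(ipC _ _ (A2 _)).
lra.
Qed.

(** Strict negativity on nontrivial combinations forces [v] to be independent, so this is an
    n-dimensional negative subspace. *)
Definition negative_op (A : V -> V) (n : nat) := exists v : 'I_n -> V,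
  forall c : 'I_n -> R[i], (exists i, c i != 0) ->
  ip (A (\sum_i c i *: v i)) (\sum_i c i *: v i) < 0.

(** The form of H - s needs a chosen value [k i] at each [h i]; for selfadjoint [H] the choice is
    immaterial, since the multivalued part is orthogonal to the domain. *)
Definition negative_rel (H : set (V * V)) (s : R) (n : nat) :=
  exists h k : 'I_n -> V, (forall i, H (h i, k i)) /\
  forall c : 'I_n -> R[i], (exists i, c i != 0) ->
  ip (\sum_i c i *: k i - s%:C *: \sum_i c i *: h i) (\sum_i c i *: h i) < 0.

Lemma negative_op_le A1 A2 n : (forall f, ip (A1 f) f <= ip (A2 f) f) ->
  negative_op A2 n -> negative_op A1 n.
Proof. by move=> A12 [v hv]; exists v => c /hv; exact: le_lt_trans. Qed.

(** The form of [B] at A w is the form of [A] at w. *)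
Lemma negative_op_inv A B n : linear_op A -> symmetric_op A -> cancel A B ->
  negative_op A n -> negative_op B n.
Proof.
move=> lA sA AB [v hv]; exists (fun i => A (v i)) => c /hv.
by rewrite -linear_op_sum// AB sA.
Qed.

(** The additional vector is B1 v - B2 v: by [schur_bound], the form of [A1] at N + t (B1 v - B2 v)
    is at most <A2 N, N> + |t|^2 (<B1 v, v> - <B2 v, v>). *)
Lemma negative_opS A1 A2 B1 B2 n v :
  linear_op A1 -> linear_op A2 -> symmetric_op A1 -> symmetric_op A2 ->
  (forall f, ip (A1 f) f <= ip (A2 f) f) -> cancel B1 A1 -> cancel B2 A2 ->
  ip (B1 v) v < ip (B2 v) v -> negative_op A2 n -> negative_op A1 n.+1.
Proof.
move=> l1 l2 s1 s2 A12 B1K B2K Bv [w hw].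
exists (with_head (B1 v - B2 v) w) => c cn0; rewrite sum_with_head.
set N := \sum_i _; set t := c ord0; rewrite addrC scalerBr.
have uw : A1 (t *: B1 v) = A2 (t *: B2 v) by rewrite !linear_opZ// B1K B2K.
apply: le_lt_trans (schur_bound _ l1 l2 s1 s2 A12 uw) _.
rewrite linear_opZ// B1K !ipZZ -mulrBr.
(* If a coefficient of the old family is nonzero, the first term is strictly negative; otherwise [t]
   is nonzero and the second one is. *)
have [[j cj]|/forallNP c0] := pselect (exists j, c (lift ord0 j) != 0).
  have := hw (fun j => c (lift ord0 j)) (ex_intro _ j cj); rewrite -/N.
  have : 0 <= complex.Re (t * t^*).
    by case: (t) => a b /=; rewrite mulrN opprK addr_ge0// -expr2 sqr_ge0.
  move: (complex.Re _) => r r0; move: Bv; nra.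
have N0 : N = 0.
  apply: big1 => j _; have := c0 j; case: eqP => [-> _|_ /(_ erefl)//].
  by rewrite scale0r.
have t0 : t != 0.
  case: cn0 => i; case: (unliftP ord0 i) => [j ->|->//] cj.
  by case: (c0 j).
rewrite N0 ip0r add0r pmulr_rlt0 ?subr_lt0//.
case: (t) t0 => a b /= ab; rewrite mulrN opprK -!expr2 lt_def addr_ge0 ?sqr_ge0//.
rewrite andbT paddr_eq0 ?sqr_ge0// !sqrf_eq0; apply: contra ab.
by move=> /andP[/eqP -> /eqP ->].
Qed.

(* Uses <(1 - c R)h, h> <= |h - c k|^2 + c <(H - s)k, k> for k in dom H, which
   is an equality for k = R h, where c = s - x. *)
Lemma negative_op_rel (H : set (V * V)) x s m Rx n : selfadjoint dotp H ->
  form_lower_bound dotp H m -> x <= m -> x < s -> has_resolvent H x Rx ->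
  negative_op (one_plus (x - s) Rx) n <-> negative_rel H s n.
Proof.
move=> sa hm xm xs hR; have lR := resolvent_lin sa hR.
have cs : 0 < s - x by rewrite subr_gt0.
split=> [[v hv]|[h [k [hk hneg]]]].
  exists (fun i => Rx (v i)), (fun i => v i + x%:C *: Rx (v i)).
  split=> [i|c /hv]; first exact: hR.
  rewrite -(linear_op_sum c v (one_plus_linear x lR)) -(linear_op_sum c v lR).
  move: (\sum_i _) => w; rewrite /one_plus -addrA -scalerBl -rmorphB.
  have := ip_ge0 dotp (w + (x - s)%:C *: Rx w).
  rewrite !ipE (ipC _ w) => h1 h2; rewrite -(pmulr_rlt0 _ cs); nra.
(* Taking the vector of the whole space to be s - x times the vector of the domain makes the square
   in the inequality vanish. *)
exists (fun i => (s - x)%:C *: h i) => c /hneg; have := rel_sum sa c hk.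
have -> : \sum_i c i *: ((s - x)%:C *: h i) = (s - x)%:C *: \sum_i c i *: h i.
  by rewrite scaler_sumr; apply: eq_bigr => i _; rewrite !scalerA mulrC.
move: (\sum_i _) (\sum_i _) => g f fg neg.
set Rf := Rx ((s - x)%:C *: f).
have := relB sa fg (hR ((s - x)%:C *: f)); rewrite -/Rf => /hm.
have : x * ip (f - Rf) (f - Rf) <= m * ip (f - Rf) (f - Rf).
  by rewrite ler_wpM2r// ip_ge0.
have := resolvent_sym sa hR (g - x%:C *: f) ((s - x)%:C *: f).
rewrite -(resolventE sa hR fg) -/Rf.
rewrite /one_plus -/Rf !ipE => h1 h2 h3; move: neg; rewrite !ipE => neg.
rewrite -[x - s]opprB mulNr -mulrBr.
have -> : (s - x) * ip f f - (s - x) * ip Rf f = ip g Rf - s * ip f Rf.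
  by move: h1; rewrite (ipC _ Rf f); lra.
rewrite pmulr_rlt0//; apply: le_lt_trans neg.
by move: h1 h2 h3; rewrite (ipC _ Rf f); lra.
Qed.

End Ordering.

(** * The relation -H^-1 *)

Section ShiftAndInverse.
Variables (R : realType) (V : completeNormedModType R[i]).
Variable dotp : {dot V for Num.conj}.
Hypothesis hilbertV : hilbert_form dotp.
Local Notation ip := (rdot dotp).
Local Notation nr := (hnorm dotp).

Lemma lower_bound_resolvent (H : set (V * V)) x m : selfadjoint dotp H ->
  form_lower_bound dotp H m -> x < m -> exists G, has_resolvent H x G.
Proof.
move=> sa hm xm; have d0 : 0 < m - x by rewrite subr_gt0.
apply: (resolvent_exists hilbertV sa d0) => h k hk.
have [->|h0] := eqVneq h 0; first by rewrite nr0 mulr0 nr_ge0.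
have nh : 0 < nr h.
  by rewrite lt_def nr_ge0 andbT; apply: contra h0 => /eqP/nr_eq0 ->.
rewrite -(ler_pM2r nh) (le_trans _ (le_trans (ler_norm _) (ip_le_nr _ _ _)))//.
by rewrite -mulrA -expr2 nr2 !ipE; have := hm _ _ hk; lra.
Qed.

(** The ordering is given at one point and is carried to all smaller ones. For x < x0, with [R1],
    [R2] the resolvents at [x0], the operators 1 + (x0 - x) R_j are positive with inverses 1 + (x -
    x0) G_j, and inversion reverses the order. *)
Lemma relation_le_below (H1 H2 : set (V * V)) :
  selfadjoint dotp H1 -> selfadjoint dotp H2 -> relation_le dotp H1 H2 ->
  exists x0 m, [/\ x0 < m, form_lower_bound dotp H1 m,
    form_lower_bound dotp H2 m & forall x, x <= x0 -> exists G1 G2,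
    [/\ has_resolvent H1 x G1, has_resolvent H2 x G2 &
      forall h, ip (G2 h) h <= ip (G1 h) h]].
Proof.
move=> sa1 sa2 /(relation_leP hilbertV sa1 sa2).
move=> [x0 [m [R1 [R2 [xm [hm1 hm2] hR1 hR2 R12]]]]].
exists x0, m; split=> // x; rewrite le_eqVlt => /predU1P[->|xx0].
  by exists R1, R2.
have xm' := lt_trans xx0 xm.
have [G1 hG1] := lower_bound_resolvent sa1 hm1 xm'.
have [G2 hG2] := lower_bound_resolvent sa2 hm2 xm'.
exists G1, G2; split=> // h.
have A12 f : ip (one_plus (x0 - x) R2 f) f <= ip (one_plus (x0 - x) R1 f) f.
  by rewrite /one_plus !ipE lerD2l ler_wpM2l// subr_ge0 ltW.
have K1 := one_plus_resolventK sa1 hR1 hG1.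
have K2 := one_plus_resolventK sa2 hR2 hG2.
have l1 := one_plus_linear (x0 - x) (resolvent_lin sa1 hR1).
have l2 := one_plus_linear (x0 - x) (resolvent_lin sa2 hR2).
have s1 := one_plus_symmetric (x0 - x) (resolvent_sym sa1 hR1).
have s2 := one_plus_symmetric (x0 - x) (resolvent_sym sa2 hR2).
(* At n = 0 this says that the difference of the inverse forms at [h] dominates a value of the form
   of a positive operator. *)
have := schur_bound 0 l2 l1 s2 s1 A12 (etrans (K2 h) (esym (K1 h))).
rewrite (linear_op0 l1) ip0l !add0r K2.
move: (one_plus _ G2 h - one_plus _ G1 h) => z le; have : 0 <= ip (one_plus (x0 - x) R2 z) z.
  rewrite /one_plus !ipE addr_ge0 ?ip_ge0//.
  apply: mulr_ge0; first by rewrite subr_ge0 ltW.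
  apply: le_trans (resolvent_form hR2 hm2 z).
  by rewrite mulr_ge0 ?ip_ge0// subr_ge0 ltW.
move/le_trans => /(_ _ le); rewrite /one_plus !ipE.
have -> : forall a b, ip h h + (x - x0) * a - (ip h h + (x - x0) * b) =
  (x0 - x) * (b - a) by move=> a b; ring.
by rewrite pmulr_rge0 ?subr_gt0// subr_ge0.
Qed.

Section NegativeInverse.
Variable H : set (V * V).
Hypothesis sa : selfadjoint dotp H.
Local Notation T := (opposite (inverse H)).

Lemma opp_inverseP h k : T (h, k) <-> H (- k, h).
Proof.
split=> [[_ [[u v] huv <-] [<- <-]]|hk]; first by rewrite opprK.
by exists (h, - k); [exists (- k, h)|rewrite /= opprK].
Qed.

Lemma opp_inverse_selfadjoint : selfadjoint dotp T.
Proof.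
split.
  split; first by rewrite in_setE; apply/opp_inverseP; rewrite oppr0; exact: rel0 sa.
  move=> a [h k] [f g]; rewrite !in_setE => /opp_inverseP hk /opp_inverseP fg.
  apply/opp_inverseP; have := rel_lin sa a hk fg; rewrite scalerN -opprD.
  exact.
apply/seteqP; split=> -[h k].
  move=> /opp_inverseP; rewrite {1}sa.2 => hk -[f g] /opp_inverseP/hk/=.
  by rewrite linearNr linearNl => /oppr_inj ->.
move=> hk; apply/opp_inverseP; rewrite sa.2 => -[f g] fg /=.
have := hk (g, - f); rewrite linearNr linearNl/= => <-; rewrite ?opprK//.
by apply/opp_inverseP; rewrite opprK.
Qed.

(** The domain of -H^-1 is the closed range of [H], so the operator part values lie in that range;
    [closed_range_bound] gives |k| <= C |h|, and Cauchy-Schwarz the form bound. *)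
Lemma opp_inverse_bound : closed (range_of H) -> exists2 C : R, 0 < C &
  form_lower_bound dotp T (- C).
Proof.
move=> clR; have [C C0 hC] := closed_range_bound hilbertV sa clR; exists C => //.
move=> h k' /(operator_part_of hilbertV opp_inverse_selfadjoint).
move=> [k [hk [_ /= ck]] <-] {k'}.
have domT : domain_of T = range_of H.
  by apply/seteqP; split=> g [f fg]; exists (- f);
    [exact/opp_inverseP|apply/opp_inverseP; rewrite opprK].
have Rk : range_of H (- k).
  rewrite -scaleN1r; apply: subspaceZ (rel_range sa) _; apply: clR.
  by rewrite -domT.
have := hC _ _ ((opp_inverseP _ _).1 hk) Rk; rewrite nrN -nr2 mulNr => kh.
have := ip_le_nr dotp k h; rewrite ler_norml => /andP[+ _].
apply: le_trans; rewrite lerN2 expr2 mulrA ler_wpM2r ?nr_ge0//.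
Qed.

(** With s = -1/y, this solves (-H^-1 - y)^-1 = s + s^2 (H - s)^-1 for the second resolvent. The
    coefficient y^2 is positive, so comparisons of resolvents carry over. *)
Lemma resolvent_of_opp_inverse y S : y < 0 -> has_resolvent T y S ->
  has_resolvent H (- y^-1) (fun g => y%:C *: g + (y ^+ 2)%:C *: S g).
Proof.
move=> y0 hS g; have /opp_inverseP/(relZ sa (- y%:C)) := hS g.
congr (H (_, _)).
  by rewrite scalerN scaleNr opprK scalerDr scalerA -rmorphM.
rewrite scalerDr !scalerA -!rmorphM/= mulNr mulVf ?lt_eqF//.
rewrite expr2 mulNr mulKf ?lt_eqF//.
by rewrite !rmorphN rmorph1 !scaleNr scale1r addrA subrr add0r.
Qed.

End NegativeInverse.
End ShiftAndInverse.

(** * Spectral measures *)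

Lemma norm_le_1Dsqr (R : realDomainType) (t : R) : `|t| <= 1 + t ^+ 2.
Proof. by rewrite ler_norml; apply/andP; split; nra. Qed.

(** * Means of finite measures on the line with restricted support *)

Section MeasureOnReals.
Variables (R : realType) (nu : {measure set (measurableTypeR R) -> \bar R}).
Hypothesis nu_fin : (nu setT < +oo)%E.
Local Notation mean := (Rintegral nu setT (fun t : measurableTypeR R => t)).

Lemma bounded_integrable_cst c : nu.-integrable setT (EFin \o cst c).
Proof.
apply/integrableP; split; first exact/measurable_EFinP.
by rewrite /= (integral_cst nu measurableT `|c|%:E) lte_mul_pinfty// lee_fin.
Qed.

Lemma square_integrable_id : (\int[nu]_t (t ^+ 2)%:E < +oo)%E ->
  nu.-integrable setT (fun t : measurableTypeR R => t%:E).
Proof.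
move=> t2; pose g (t : measurableTypeR R) := (1%:E + (t ^+ 2)%:E)%E : \bar R.
apply: (@le_integrable _ _ _ _ _ measurableT _ g).
- exact/measurable_EFinP.
- move=> t _; rewrite /g -EFinD/= lee_fin [leRHS]ger0_norm ?addr_ge0 ?sqr_ge0//.
  exact: norm_le_1Dsqr.
apply: integrableD => //; first exact: bounded_integrable_cst.
apply/integrableP; split; first by apply/measurable_EFinP; exact: exprn_measurable.
by under eq_integral do rewrite /= ger0_norm ?sqr_ge0//.
Qed.

Lemma bounded_square_integrable (A : set (measurableTypeR R)) b :
  measurable A -> nu (~` A) = 0 -> (forall t, A t -> `|t| <= b) ->
  (\int[nu]_t (t ^+ 2)%:E < +oo)%E.
Proof.
move=> mA A0 Ab.
apply: (@le_lt_trans _ _ (\int[nu]_t (cst (b ^+ 2)%:E t))%E); last first.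
  by rewrite integral_cst// lte_mul_pinfty// lee_fin sqr_ge0.
apply: ae_ge0_le_integral => //.
- by move=> t _; rewrite lee_fin sqr_ge0.
- by apply/measurable_EFinP; exact: exprn_measurable.
- by move=> t _; rewrite lee_fin sqr_ge0.
exists (~` A); split=> //; first exact: measurableC.
move=> t /= h At; apply: h => _; rewrite lee_fin -real_normK ?num_real//.
by rewrite ler_sqr ?nnegrE ?Ab// (le_trans _ (Ab _ At)).
Qed.

Section Support.
Hypothesis int_id : nu.-integrable setT (fun t : measurableTypeR R => t%:E).
Variable A : set (measurableTypeR R).
Hypotheses (mA : measurable A) (A0 : nu (~` A) = 0).

Let intA (f : measurableTypeR R -> \bar R) : nu.-integrable setT f ->
  (\int[nu]_t f t = \int[nu]_(t in A) f t)%E.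
Proof.
move=> fi; rewrite (negligible_integral (measurableC mA))//.
by rewrite setTD setCK.
Qed.

Let Aint (f : measurableTypeR R -> \bar R) : nu.-integrable setT f ->
  nu.-integrable A f.
Proof. by move=> fi; apply: integrableS fi. Qed.

Let EFin_mean : (mean%:E = \int[nu]_(t in A) t%:E)%E.
Proof. by rewrite -intA// fineK//; exact: integrable_fin_num. Qed.

Let EFin_total c : ((c * fine (nu setT))%:E = \int[nu]_(t in A) c%:E)%E.
Proof.
rewrite EFinM fineK ?ge0_fin_numE// -(integral_cst nu measurableT).
by rewrite intA//; exact: bounded_integrable_cst.
Qed.

Lemma le_mean a : (forall t, A t -> a <= t) -> a * fine (nu setT) <= mean.
Proof.
move=> aA; rewrite -lee_fin EFin_mean EFin_total; apply: le_integral => //.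
- by apply: Aint; exact: bounded_integrable_cst.
- exact: Aint.
- by move=> t /set_mem At; rewrite lee_fin aA.
Qed.

Lemma mean_le b : (forall t, A t -> t <= b) -> mean <= b * fine (nu setT).
Proof.
move=> bA; rewrite -lee_fin EFin_mean EFin_total; apply: le_integral => //.
- exact: Aint.
- by apply: Aint; exact: bounded_integrable_cst.
- by move=> t /set_mem At; rewrite lee_fin bA.
Qed.

(** The integral of |e t| over the support is e times the mean. The factor [e] serves as a sign: 1
    for positive and -1 for negative supports. *)
Lemma mean_eq0 (e : R) : (forall t, A t -> 0 < e * t) -> mean = 0 ->
  nu setT = 0.
Proof.
move=> eA m0; have mf : measurable_fun A (fun t : measurableTypeR R => (e * t)%:E).
  exact/measurable_EFinP/measurable_funM.
have : (\int[nu]_(t in A) `|(e * t)%:E|)%E = 0.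
  under eq_integral => t /set_mem At do rewrite gee0_abs ?lee_fin ?ltW ?eA// EFinM.
  by rewrite integralZl//; [rewrite -EFin_mean m0 mule0|exact: Aint].
move=> /(ae_eq_integral_abs _ mA mf)[N [mN N0 NA]].
have nA : nu A = 0.
  apply: (subset_measure0 mA mN _ N0) => t At; apply: NA => /(_ At) /= [et0].
  by have := eA _ At; rewrite et0 ltxx.
have -> : [set: measurableTypeR R] = A `|` ~` A by rewrite setUv.
have := @measureU _ _ _ nu A (~` A) mA (measurableC mA) (setICr A).
move=> ->; apply: etrans (congr2 (fun a b => (a + b)%E) nA A0) _.
by rewrite adde0.
Qed.

End Support.
End MeasureOnReals.

(** * Vectors in spectral subspaces and the form of the relation on them *)

Section SpectralMeasure.
Variables (R : realType) (V : completeNormedModType R[i]).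
Variable dotp : {dot V for Num.conj}.
Hypothesis hilbertV : hilbert_form dotp.
Local Notation ip := (rdot dotp).
Local Notation nr := (hnorm dotp).
Local Notation mT := (measurableTypeR R).

Variable H : set (V * V).
Hypothesis sa : selfadjoint dotp H.
Variables (E : set mT -> V -> V) (mu : V -> {measure set mT -> \bar R}).
Hypothesis spH : spectral_measure_of dotp H E mu.
Implicit Types A B : set mT.

Let pvm : projection_valued_measure dotp E mu. Proof. by case: spH. Qed.

Lemma spec_linear A : measurable A -> linear_op (E A).
Proof. by case: pvm => h _ _ /h[lE _ _] c u v; rewrite lE. Qed.

Lemma specI A B h : measurable A -> measurable B -> E (A `&` B) h = E A (E B h).
Proof. by case: pvm => _ EI _ mA mB; rewrite EI. Qed.

Lemma spec_idem A h : measurable A -> E A (E A h) = E A h.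
Proof. by move=> mA; rewrite -specI// setIid. Qed.

Lemma spec_sym A u v : measurable A -> ip (E A u) v = ip u (E A v).
Proof. by case: pvm => h _ _ /h[_ _ sE]; rewrite /rdot sE. Qed.

Lemma specC A B h : measurable A -> measurable B -> E A (E B h) = E B (E A h).
Proof. by move=> mA mB; rewrite -!specI// setIC. Qed.

Lemma mu_spec h A : measurable A -> mu h A = (ip (E A h) h)%:E.
Proof. by case: pvm => _ _; apply. Qed.

Lemma mu_spec_sq h A : measurable A -> mu h A = (ip (E A h) (E A h))%:E.
Proof. by move=> mA; rewrite mu_spec// -{1}spec_idem// spec_sym. Qed.

Lemma mu_eq0 h A : measurable A -> mu h A = 0 <-> E A h = 0.
Proof.
move=> mA; rewrite mu_spec_sq//; split=> [[]/ip_eq0//|->].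
by rewrite ip0l.
Qed.

Lemma spec0 h : E set0 h = 0.
Proof. by apply/mu_eq0 => //; rewrite measure0. Qed.

(** Only the scalar measures are given as additive. The squared norm of the difference of the two
    sides reduces to |E(A U B) h|^2 - |E(A) h|^2 - |E(B) h|^2, which is 0. *)
Lemma specU A B h : measurable A -> measurable B -> A `&` B = set0 ->
  E (A `|` B) h = E A h + E B h.
Proof.
move=> mA mB AB; have mAB := measurableU _ _ mA mB.
have : mu h (A `|` B) = (mu h A + mu h B)%E by rewrite measureU.
rewrite !mu_spec_sq// -EFinD => -[e].
have ea : ip (E (A `|` B) h) (E A h) = ip (E A h) (E A h).
  by rewrite -{1}(spec_idem _ mA) -spec_sym// -specI// setIC setUK.
have eb : ip (E (A `|` B) h) (E B h) = ip (E B h) (E B h).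
  by rewrite -{1}(spec_idem _ mB) -spec_sym// -specI// setIC setUC setUK.
have ab : ip (E A h) (E B h) = 0.
  by rewrite spec_sym// -specI// AB spec0 ip0r.
apply/eqP; rewrite -subr_eq0; apply/eqP; apply: (@ip_eq0 _ _ dotp).
rewrite !ipE (ipC _ (E A h) (E (A `|` B) h)) (ipC _ (E B h) (E (A `|` B) h)).
by rewrite (ipC _ (E B h) (E A h)) ea eb ab e; lra.
Qed.

Lemma specT h k : H (h, k) -> E setT h = h.
Proof.
move=> hk; case: spH => _ rT _ _.
have : closure (domain_of H) h by apply: subset_closure; exists k.
by rewrite -rT => -[u _ <-]; rewrite spec_idem.
Qed.

Lemma spec_supp A B h : measurable A -> measurable B -> E B h = h ->
  A `&` B = set0 -> E A h = 0.
Proof. by move=> mA mB <- AB; rewrite -specI// AB spec0. Qed.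

Lemma mu_suppC B h : measurable B -> E B h = h -> mu h (~` B) = 0.
Proof.
move=> mB Bh; apply/mu_eq0; first exact: measurableC.
by apply: spec_supp Bh _ => //; [exact: measurableC|exact: setICl].
Qed.

Lemma spec_sub A B h : measurable A -> measurable B -> A `<=` B ->
  E A h = h -> E B h = h.
Proof.
move=> mA mB AB <-; rewrite -specI//; congr (E _ _); apply/setIidPr => //.
Qed.

Lemma mu_fin h : (mu h setT < +oo)%E.
Proof. by rewrite mu_spec// ltry. Qed.

Lemma mu_total h k : H (h, k) -> fine (mu h setT) = ip h h.
Proof. by move=> /specT hT; rewrite mu_spec_sq// hT. Qed.

Lemma domain_square h k : H (h, k) -> (\int[mu h]_t (t ^+ 2)%:E < +oo)%E.
Proof.
move=> hk; have : domain_of H h by exists k.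
by case: spH => _ _ -> _ [].
Qed.

Lemma domain_integrable h k : H (h, k) ->
  (mu h).-integrable setT (fun t : mT => t%:E).
Proof.
by move=> /domain_square; apply: square_integrable_id; exact: mu_fin.
Qed.

Lemma form_mean h k : H (h, k) -> ip k h = Rintegral (mu h) setT (fun t => t).
Proof.
move=> /(operator_part_of hilbertV sa)[k' hk' <-].
by case: spH => _ _ _ /(_ _ _ hk'); rewrite /rdot => ->.
Qed.

Lemma bounded_domain B b h : measurable B -> (forall t, B t -> `|t| <= b) ->
  E B h = h -> exists k, operator_part H (h, k).
Proof.
move=> mB Bb Bh; suff [k hk] : domain_of H h.
  by have [k' hk' _] := operator_part_of hilbertV sa hk; exists k'.
case: (spH) => _ rT -> _; split.
  by rewrite -rT; exists h => //; exact: spec_sub Bh.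
apply: (bounded_square_integrable (mu_fin h) mB _ Bb).
exact: mu_suppC.
Qed.

Section SupportedForm.
Variables (B : set mT) (h k : V).
Hypotheses (mB : measurable B) (hk : H (h, k)) (Bh : E B h = h).

Lemma le_form a : (forall t, B t -> a <= t) -> a * ip h h <= ip k h.
Proof.
rewrite (form_mean hk) -(mu_total hk); apply: le_mean => //.
- exact: mu_fin.
- exact: domain_integrable hk.
- exact: mu_suppC.
Qed.

Lemma form_le b : (forall t, B t -> t <= b) -> ip k h <= b * ip h h.
Proof.
rewrite (form_mean hk) -(mu_total hk); apply: mean_le => //.
- exact: mu_fin.
- exact: domain_integrable hk.
- exact: mu_suppC.
Qed.

Lemma form_eq0 e : (forall t, B t -> 0 < e * t) -> ip k h = 0 -> h = 0.
Proof.
rewrite (form_mean hk) => eB m0; have hT := specT hk; rewrite -hT.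
apply/mu_eq0 => //; apply: (mean_eq0 _ mB _ eB) => //.
- exact: domain_integrable hk.
- exact: mu_suppC.
Qed.

End SupportedForm.

(** The measure of h + g is the sum of those of h and g, so the form is additive on this pair; the
    two cross terms are equal by symmetry, hence zero. *)
Lemma spec_orthogonal B h k g l : measurable B -> H (h, k) -> H (g, l) ->
  E B h = h -> E B g = 0 -> ip k g = 0.
Proof.
move=> mB hk gl Bh Bg.
have hgkl := relD sa hk gl.
have mD A : measurable A -> mu (h + g) A = measure_add (mu h) (mu g) A.
  move=> mA; rewrite measure_addE !mu_spec// -EFinD; congr (_%:E).
  have e0 : ip (E A h) g = 0.
    by rewrite -Bh specC// spec_sym// Bg ip0r.
  rewrite (linear_opD _ _ (spec_linear mA)) !ipE e0.
  by rewrite (spec_sym g h mA) (ipC _ g) e0 addr0 add0r.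
have : ip (k + l) (h + g) = ip k h + ip l g.
  rewrite (form_mean hk) (form_mean gl) (form_mean hgkl) /Rintegral.
  rewrite (eq_measure_integral (measure_add (mu h) (mu g))); last first.
    by move=> A mA _; exact: mD.
  have i1 := domain_integrable hk; have i2 := domain_integrable gl.
  by rewrite integral_measure_add// fineD//; exact: integrable_fin_num.
by have := rel_sym sa hk gl; rewrite (ipC _ g k) !ipE => ->; lra.
Qed.

(** The vector k - E B k is orthogonal to the domain by [spec_orthogonal], and it lies in the
    closure of the domain, so it vanishes. *)
Lemma spec_image B b h k : measurable B -> (forall t, B t -> `|t| <= b) ->
  E B h = h -> operator_part H (h, k) -> E B k = k.
Proof.
move=> mB Bb Bh [hk [_ /= ck]]; apply/eqP; rewrite eq_sym -subr_eq0; apply/eqP.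
apply: (@ip_eq0 _ _ dotp); apply: (ip_closure0 hilbertV (M := domain_of H)).
  move=> g [l gl].
  have [l' [gl' _]] := bounded_domain mB Bb (spec_idem g mB).
  have : ip k (g - E B g) = 0.
    apply: (spec_orthogonal mB hk (relB sa gl gl') Bh).
    have -> : g - E B g = 1 *: g + (-1) *: E B g by rewrite scaleN1r scale1r.
    rewrite (spec_linear mB) (linear_opZ _ _ (spec_linear mB)) spec_idem//.
    by rewrite scale1r scaleN1r subrr.
  by rewrite !ipE spec_sym.
case: spH => _ rT _ _; rewrite -rT.
have kT : E setT k = k by move: ck; rewrite -rT => -[u _ <-]; rewrite spec_idem.
exists (k - E B k) => //; have -> : k - E B k = 1 *: k + (-1) *: E B k.
  by rewrite scaleN1r scale1r.
rewrite (spec_linear measurableT) (linear_opZ _ _ (spec_linear measurableT)).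
by rewrite kT -specI// setTI.
Qed.

(** This is H^2 <= s H on the range of [E B]: the form is nonnegative at h - k/s and at most s |k|^2
    at k. *)
Lemma spec_image_bound B s h : measurable B ->
  (forall t, B t -> 0 <= t <= s) -> 0 < s -> E B h = h ->
  exists2 k, H (h, k) & ip k k <= s * ip k h.
Proof.
move=> mB Bs s0 Bh.
have Bb t : B t -> `|t| <= s by move=> /Bs/andP[t0 ts]; rewrite ger0_norm.
have [k hk] := bounded_domain mB Bb Bh; exists k; first by case: hk.
have Bk := spec_image mB Bb Bh hk; case: hk => hk _.
have [l [kl _]] := bounded_domain mB Bb Bk.
have Bs0 t : B t -> 0 <= t by move=> /Bs/andP[].
have Bs1 t : B t -> t <= s by move=> /Bs/andP[].
have Bhk : E B (h + (- s^-1)%:C *: k) = h + (- s^-1)%:C *: k.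
  by rewrite addrC (spec_linear mB) Bh Bk.
have := le_form mB (relD sa hk (relZ sa (- s^-1)%:C kl)) Bhk Bs0.
have := form_le mB kl Bk Bs1.
rewrite mul0r !ipE (rel_sym sa hk kl) => h1 h2.
rewrite -(ler_pM2l (_ : 0 < s^-1)) ?invr_gt0// mulKf ?gt_eqF//.
have : s^-1 * (s^-1 * ip l k) <= s^-1 * ip k k.
  by rewrite ler_pM2l ?invr_gt0// ler_pdivrMl.
lra.
Qed.

(** On this spectral subspace |k|^2 <= s <k, h>, while the bound on -H^-1 at (k, -h) reads m |k|^2
    <= - <k, h>; as 1 + m s > 0, this forces <k, h> = 0. *)
Lemma spec_gap m s : form_lower_bound dotp (opposite (inverse H)) m ->
  0 < s -> - s^-1 < m -> forall h, E `]0, s]%classic h = 0.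
Proof.
move=> hm s0 sm h; set B := `]0, s]%classic : set mT.
have mB : measurable B by exact: measurable_itv.
have Bpos t : B t -> 0 < t <= s by rewrite /B /= in_itv.
have Bh := spec_idem h mB; move: (E B h) Bh => {}h Bh.
have [|k hk kk] := spec_image_bound mB _ s0 Bh.
  by move=> t /Bpos/andP[/ltW -> ->].
apply: (form_eq0 mB hk Bh (e := 1)).
  by move=> t /Bpos/andP[t0 _]; rewrite mul1r.
have q0 : 0 <= ip k h.
  have := le_form mB hk Bh (a := 0); rewrite mul0r; apply.
  by move=> t /Bpos/andP[/ltW].
have /hm : opposite (inverse H) (k, - h) by exists (k, h) => //; exists (h, k).
rewrite ipNl (ipC _ h) => mk.
have sms : 0 < 1 + m * s.
  by rewrite -ltrBlDl sub0r -ltr_pdivrMr// mulN1r.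
(* For m >= 0 the bound on -H^-1 alone gives <k, h> <= 0. *)
have [m0|m0] := leP 0 m; first by have := ip_ge0 dotp k; nra.
nra.
Qed.

End SpectralMeasure.

(** * Inertia as a negative index *)

Section Index.
Variables (R : realType) (V : completeNormedModType R[i]).
Variable dotp : {dot V for Num.conj}.
Hypothesis hilbertV : hilbert_form dotp.
Local Notation ip := (rdot dotp).
Local Notation mT := (measurableTypeR R).

Definition independent_size (W : set V) : set nat := [set n : nat |
    exists2 v : 'I_n -> V, (forall i, W (v i)) & linearly_independent v].

Lemma independent_size0 W : independent_size W 0%N.
Proof. by exists (fun=> 0) => [[]|c _ []]. Qed.

Lemma finite_dimension W : (dimension W < +oo)%E ->
  exists n (v : 'I_n -> V), dimension W = n%:R%:E /\
    forall w, W w -> exists c : 'I_n -> R[i], w = \sum_j c j *: v j.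
Proof.
move=> /(nat_sup_attained (independent_size0 W))[n [[v Wv vi] dimW nmax]].
exists n, v; split=> // w Ww; apply: maximal_independent_span => // ind.
have /nmax : independent_size W n.+1; last by rewrite ltnn.
exists (with_head w v) => // i; rewrite /with_head.
by case: (unliftP ord0 i).
Qed.

Variable H : set (V * V).
Hypothesis sa : selfadjoint dotp H.
Variables (E : set mT -> V -> V) (mu : V -> {measure set mT -> \bar R}).
Hypothesis spH : spectral_measure_of dotp H E mu.
Local Notation Eneg := (E `]-oo, 0[%classic).

(** On a bounded piece the vectors lie in the domain and the form is both at least m |h|^2 and at
    most (m - 1) |h|^2. Countably many pieces cover the half-line. *)
Lemma spec_below m : form_lower_bound dotp H m ->
  forall h, E `]-oo, m - 1]%classic h = 0.
Proof.
move=> hm h; apply/(mu_eq0 spH); first exact: measurable_itv.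
apply/negligibleP; first exact: measurable_itv.
have -> : `]-oo, m - 1]%classic = \bigcup_n `[- n%:R, m - 1]%classic :> set mT.
  apply/seteqP; split=> [t|t [n _]]; rewrite /= !in_itv/=; last by case/andP.
  move=> tm; exists (Num.truncn `|t|).+1 => //=; rewrite in_itv/= tm andbT.
  by rewrite lerNl ltW// (le_lt_trans _ (truncnS_gt _))// -normrN ler_norm.
apply: negligible_bigcup => n; set B := `[_, _]%classic.
have mB : measurable B by exact: measurable_itv.
apply/negligibleP => //; apply/(mu_eq0 spH) => //.
have Bh := spec_idem spH h mB; move: (E B h) Bh => {}h Bh.
have BP t : B t -> - n%:R <= t <= m - 1 by rewrite /B /= in_itv.
have [|k [hk _]] := bounded_domain hilbertV sa spH (b := n%:R + `|m|) mB _ Bh.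
  move=> t /BP/andP[nt tm]; rewrite ler_norml; apply/andP; split.
    by rewrite (le_trans _ nt)// lerN2 lerDl.
  by have := ler_norm m; have := ler0n R n; lra.
have := form_le hilbertV sa spH mB hk Bh (b := m - 1).
have := hm _ _ hk; have := ip_ge0 dotp h => h0 h1 h2.
apply: (@ip_eq0 _ _ dotp); have : ip k h <= (m - 1) * ip h h.
  by apply: h2 => t /BP/andP[].
by lra.
Qed.

Lemma spec_point_kernel h : E [set 0] h = h -> H (h, 0).
Proof.
move=> h0; have m0 : measurable [set 0 : mT] by exact: measurable_set1.
have [|k hk kk] := spec_image_bound hilbertV sa spH m0 _ ltr01 h0.
  by move=> t ->; rewrite lexx ler01.
have := form_le hilbertV sa spH m0 hk h0 (b := 0).
rewrite mul0r => q0; suff <- : k = 0 by [].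
apply: (@ip_eq0 _ _ dotp); apply/eqP; rewrite eq_le ip_ge0 andbT.
rewrite (le_trans kk)// mul1r q0// => t ->.
exact: lexx.
Qed.

(** On sums of vectors from the negative spectral subspace and the kernel the form of [H] is
    nonpositive, so subtracting [s] makes it negative at every nonzero vector. *)
Lemma negative_rel_index (s : R) p q : 0 < s ->
  (exists m, form_lower_bound dotp H m) ->
  independent_size (range Eneg) p -> independent_size (kernel_of H) q ->
  negative_rel dotp H s (p + q).
Proof.
move=> s0 [m hm] [a aN ai] [b bK bi].
have mN : measurable (`]-oo, 0[%classic : set mT) by exact: measurable_itv.
have Ea i : Eneg (a i) = a i.
  by have [u _ <-] := aN i; rewrite (spec_idem spH).
(* Below m - 1 there is no spectrum, so each [a i] has bounded spectral support and lies in the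
   domain. *)
have /choice[k hk] i : exists k, H (a i, k).
  pose B := `](m - 1), 0[%classic : set mT.
  have mB : measurable B by exact: measurable_itv.
  have Bi : E B (a i) = a i.
    have : E (`]-oo, m - 1]%classic `|` B) (a i) = a i.
      apply: (spec_sub spH mN _ _ (Ea i)); first by apply: measurableU.
      move=> t /=; rewrite /B/= !in_itv/= => t0.
      by have [tm|tm] := leP t (m - 1); [left|right].
    rewrite (specU spH)//; first by rewrite spec_below// add0r.
    apply/seteqP; split=> t // [/=]; rewrite /B/= !in_itv/= => tm /andP[+ _].
    by rewrite ltNge tm.
  have [|k [hk _]] := bounded_domain hilbertV sa spH (b := `|m - 1|) mB _ Bi.
    move=> t; rewrite /B/= in_itv/= => /andP[tm t0].
    by rewrite !ler0_norm ?lerN2 ?ltW// (lt_trans tm).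
  by exists k.
exists (join_families a b), (join_families k (fun=> 0)).
split=> [i|c [i ci]].
  by rewrite /join_families; case: fintype.split => j; [exact: hk|exact: bK].
rewrite !sum_join_families [X in _ + X - _]big1; last first.
  by move=> j _; rewrite scaler0.
rewrite addr0.
set A := \sum_(j < p) c _ *: a j; set B := \sum_(j < q) c _ *: b j.
set KA := \sum_(j < p) c _ *: k j.
have hA : H (A, KA) by exact: (rel_sum sa _ hk).
have hB : H (B, 0).
  have := rel_sum sa (fun j => c (rshift p j)) bK; rewrite -/B.
  by rewrite big1// => j _; rewrite scaler0.
have EA : Eneg A = A.
  rewrite /A (linear_op_sum _ _ (spec_linear spH mN)).
  by apply: eq_bigr => j _; rewrite Ea.
have qA : ip KA A <= 0.
  have := form_le hilbertV sa spH mN hA EA (b := 0); rewrite mul0r; apply.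
  by move=> t; rewrite /= in_itv/= => /ltW.
have qB : ip KA B = 0 by rewrite ipC -(rel_sym sa hA hB) ip0l.
have : 0 < ip (A + B) (A + B).
  (* If A = -B, then A is in the kernel, so its form is 0; negative spectral support then gives A =
     0. *)
  apply: ip_gt0; apply/negP => /eqP AB0.
  have hA0 : H (A, 0).
    have -> : A = - B by apply/eqP; rewrite -addr_eq0 AB0.
    by have := relZ sa (-1) hB; rewrite scaleN1r scaler0.
  have A0 : A = 0.
    apply: (form_eq0 hilbertV sa spH mN hA0 EA (e := -1)); last by rewrite ip0l.
    by move=> t; rewrite /= in_itv/= mulN1r oppr_gt0.
  have B0 : B = 0 by rewrite -AB0 A0 add0r.
  move: ci; have /(_ (fun j => c (lshift q j)) A0) := ai.
  have /(_ (fun j => c (rshift p j)) B0) := bi => cr cl.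
  by case: (split_ordP i) => j ->; rewrite ?cl ?cr eqxx.
rewrite -(pmulr_rgt0 _ s0); move: qA qB; rewrite !ipE; lra.
Qed.

(** The spectral projection to the nonpositive half-line is injective on a negative subspace of H -
    s: a vector that it kills has spectral support above [s], where the form is at least s |x|^2. *)
Lemma negative_rel_le_index (s m' : R) n : 0 < s -> - s^-1 < m' ->
  form_lower_bound dotp (opposite (inverse H)) m' -> negative_rel dotp H s n ->
  (n%:R%:E <= dimension (range Eneg) + dimension (kernel_of H))%E.
Proof.
move=> s0 sm hm [h [k [hk hneg]]].
have dim0 W : (0 <= @dimension R V W)%E.
  exact: nat_sup_ge0 (independent_size0 W).
have [->|] := eqVneq (dimension (range Eneg)) +oo%E.
  by rewrite addye ?leey// -ltNye (lt_le_trans _ (dim0 _)).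
rewrite -ltey => /finite_dimension[p [a [-> aP]]].
have [->|] := eqVneq (dimension (kernel_of H)) +oo%E.
  by rewrite addey ?leey.
rewrite -ltey => /finite_dimension[q [b [-> bP]]].
rewrite -EFinD -natrD lee_fin ler_nat.
have mN : measurable (`]-oo, 0[%classic : set mT) by exact: measurable_itv.
have m0 : measurable [set 0 : mT] by exact: measurable_set1.
have lN := spec_linear spH mN; have l0 := spec_linear spH m0.
pose f i := Eneg (h i) + E [set 0] (h i).
apply: (@independent_span_leq _ _ _ _ f (join_families a b)); last first.
  move=> i; have [|c fc] := aP (Eneg (h i)); first by exists (h i).
  have [|d fd] := bP (E [set 0] (h i)).
    by apply: spec_point_kernel; rewrite (spec_idem spH).
  exists (join_families c d); rewrite sum_join_families /f fc fd.
  by congr (_ + _); apply: eq_bigr => j _; rewrite (join_familiesl, join_familiesr).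
move=> c; under eq_bigr do rewrite /f scalerDr.
rewrite big_split/= -!linear_op_sum// => x0.
apply: contrapT => /existsNP[i /eqP ci].
have := hneg c (ex_intro _ i ci); have := rel_sum sa c hk.
move: (\sum_i c i *: h i) (\sum_i c i *: k i) x0 => x y x0 xy neg.
have N0 : `]-oo, 0[%classic `&` [set 0] = set0 :> set mT.
  by apply/seteqP; split=> t // [/=]; rewrite in_itv/= => + t0; rewrite t0 ltxx.
have xN : Eneg x = 0.
  have := congr1 Eneg x0; rewrite (linear_opD _ _ lN) (linear_op0 lN).
  by rewrite (spec_idem spH)// -(specI spH)// N0 (spec0 spH) addr0.
have x00 : E [set 0] x = 0 by rewrite -x0 xN add0r.
have mG : measurable (`]0, s]%classic : set mT) by exact: measurable_itv.
have mP : measurable (`]s, +oo[%classic : set mT) by exact: measurable_itv.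
(* Of the four pieces of the line, the negative half-line and {0} kill [x] by its choice, and ]0, s]
   by the spectral gap. *)
have xP : E `]s, +oo[%classic x = x.
  rewrite -[RHS](specT spH xy).
  have -> : [set: mT] =
      (`]-oo, 0[%classic `|` [set 0] `|` `]0, s]%classic) `|` `]s, +oo[%classic.
    apply/seteqP; split=> t // _; rewrite /= !in_itv/= andbT.
    by case: (ltrgtP t 0) => t0; rewrite ?t0; [left; left; left|
      case: (leP t s) => ts; [left; right|right]|left; left; right].
  rewrite (specU spH)//; last 2 first.
  - by do ?apply: measurableU.
  - apply/seteqP; split=> t // [+ /=]; rewrite /= !in_itv/= andbT => + st.
    by case=> [[|]|]; [move=> t0| move=> t0|move=> /andP[_]]; rewrite ?t0 in st *; lra.
  rewrite (specU spH)//; last 2 first.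
  - exact: measurableU.
  - apply/seteqP; split=> t // [+ /=]; rewrite /= !in_itv/= => + /andP[st _].
    by case; [move=> t0|move=> t0]; rewrite ?t0 in st *; lra.
  rewrite (specU spH)// xN x00 (spec_gap hilbertV sa spH hm s0 sm).
  by rewrite !add0r.
have := le_form hilbertV sa spH mP xy xP (a := s).
rewrite !ipE in neg; move=> h1; have : s * ip x x <= ip y x.
  by apply: h1 => t; rewrite /= in_itv/= andbT => /ltW.
lra.
Qed.

(** This turns the spectral inertia into an index of the form of H - s, which can be compared
    between two relations. *)
Lemma negative_index (s m' : R) : 0 < s -> - s^-1 < m' ->
  (exists m, form_lower_bound dotp H m) ->
  form_lower_bound dotp (opposite (inverse H)) m' ->
  (dimension (range Eneg) + dimension (kernel_of H))%E =
  ereal_sup [set (n%:R)%:E | n in negative_rel dotp H s].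
Proof.
move=> s0 sm hm hm'; apply/eqP; rewrite eq_le; apply/andP; split.
  have := nat_supD R (independent_size0 (range Eneg))
    (independent_size0 (kernel_of H)); apply=> p q.
  exact: negative_rel_index.
apply: ge_ereal_sup => _ [n nH <-].
exact: negative_rel_le_index sm hm' nH.
Qed.

End Index.

(** * Comparison of two relations *)

Lemma negative_rel0 (R : realType) (V : completeNormedModType R[i])
  (dotp : {dot V for Num.conj}) (H : set (V * V)) s : negative_rel dotp H s 0.
Proof.
exists (fun=> 0), (fun=> 0); split=> [j | c [j]].
  by case: j.
by case: j.
Qed.

Section Comparison.
Variables (R : realType) (V : completeNormedModType R[i]).
Variable dotp : {dot V for Num.conj}.
Local Notation ip := (rdot dotp).
Variables (H1 H2 : set (V * V)) (x s m : R) (R1 R2 G1 G2 : V -> V).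
Hypotheses (sa1 : selfadjoint dotp H1) (sa2 : selfadjoint dotp H2).
Hypotheses (hm1 : form_lower_bound dotp H1 m) (hm2 : form_lower_bound dotp H2 m).
Hypotheses (xm : x <= m) (xs : x < s).
Hypotheses (hR1 : has_resolvent H1 x R1) (hR2 : has_resolvent H2 x R2).
Hypotheses (hG1 : has_resolvent H1 s G1) (hG2 : has_resolvent H2 s G2).
Hypothesis R12 : forall h, ip (R2 h) h <= ip (R1 h) h.

Let A1 := one_plus (x - s) R1.
Let A2 := one_plus (x - s) R2.
Let B1 := one_plus (s - x) G1.
Let B2 := one_plus (s - x) G2.

Let A12 f : ip (A1 f) f <= ip (A2 f) f.
Proof. by rewrite /A1 /A2 /one_plus !ipE lerD2l ler_wnM2l// subr_le0 ltW. Qed.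

Let lA1 : linear_op A1. Proof. exact/one_plus_linear/(resolvent_lin sa1 hR1). Qed.
Let lA2 : linear_op A2. Proof. exact/one_plus_linear/(resolvent_lin sa2 hR2). Qed.
Let lB2 : linear_op B2. Proof. exact/one_plus_linear/(resolvent_lin sa2 hG2). Qed.
Let sA1 : symmetric_op dotp A1.
Proof. exact/one_plus_symmetric/(resolvent_sym sa1 hR1). Qed.
Let sA2 : symmetric_op dotp A2.
Proof. exact/one_plus_symmetric/(resolvent_sym sa2 hR2). Qed.
Let sB2 : symmetric_op dotp B2.
Proof. exact/one_plus_symmetric/(resolvent_sym sa2 hG2). Qed.

Let opE1 n := negative_op_rel n sa1 hm1 xm xs hR1.
Let opE2 n := negative_op_rel n sa2 hm2 xm xs hR2.

Lemma negative_rel_anti n : negative_rel dotp H2 s n -> negative_rel dotp H1 s n.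
Proof. by move=> /opE2/(negative_op_le A12)/opE1. Qed.

(** A negative family is carried from [A1] to its inverse [B1], then to [B2] since B2 <= B1, and
    back to [A2]. *)
Lemma negative_rel_resolvent_le n : (forall h, ip (G2 h) h <= ip (G1 h) h) ->
  negative_rel dotp H1 s n -> negative_rel dotp H2 s n.
Proof.
move=> G12 /opE1 neg1; apply/opE2.
apply: (negative_op_inv lB2 sB2 (one_plus_resolventK sa2 hR2 hG2)).
apply: (negative_op_le (A2 := B1)).
  by move=> f; rewrite /B1 /B2 /one_plus !ipE lerD2l ler_wpM2l// subr_ge0 ltW.
exact: (negative_op_inv lA1 sA1 (one_plus_resolventK sa1 hG1 hR1)).
Qed.

Lemma negative_relS n v : ip (G1 v) v < ip (G2 v) v ->
  negative_rel dotp H2 s n -> negative_rel dotp H1 s n.+1.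
Proof.
move=> G12 /opE2 neg2; apply/opE1.
apply: (negative_opS (v := v) lA1 lA2 sA1 sA2 A12
  (one_plus_resolventK sa1 hR1 hG1) (one_plus_resolventK sa2 hR2 hG2)) => //.
by rewrite /one_plus !ipE ltrD2l ltr_pM2l// subr_gt0.
Qed.

End Comparison.

Theorem theorem3p2 (R : realType) (V : completeNormedModType R[i])
    (dotp : {dot V for Num.conj}) (hilbertV : hilbert_form dotp)
    (separableV : separable_space V)
    (H1 H2 : set (V * V))
    (sa1 : selfadjoint dotp H1) (sa2 : selfadjoint dotp H2)
    (bb1 : bounded_from_below dotp H1) (bb2 : bounded_from_below dotp H2)
    (cr1 : closed (range_of H1)) (cr2 : closed (range_of H2))
    (i1 i2 : inertia R)
    (hi1 : is_inertia dotp H1 i1) (hi2 : is_inertia dotp H2 i2)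
    (fin1 : (ineg i1 + izero i1 < +oo)%E)
    (le12 : relation_le dotp H1 H2) :
  relation_le dotp (opposite (inverse H1)) (opposite (inverse H2)) <->
  (ineg i1 + izero i1 = ineg i2 + izero i2)%E.
Proof.
move: hi1 hi2 fin1 => [E1 [mu1 [sp1 ->]]] [E2 [mu2 [sp2 ->]]] /= fin1.
have [x0 [m [xm hm1 hm2 hR]]] := relation_le_below hilbertV sa1 sa2 le12.
(* The point is kept nonpositive so that it lies below every s = -1/y with y < 0. *)
have [|R1 [R2 [hR1 hR2 R12]]] := hR (Num.min x0 0); first by rewrite ge_min lexx.
have xm' : Num.min x0 0 <= m by rewrite ge_min ltW.
have saT1 := opp_inverse_selfadjoint sa1; have saT2 := opp_inverse_selfadjoint sa2.
have xs (y : R) : y < 0 -> Num.min x0 0 < - y^-1.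
  by move=> y0; rewrite gt_min oppr_gt0 invr_lt0 y0 orbT.
have s0 (y : R) : y < 0 -> 0 < - y^-1 :> R by move=> y0; rewrite oppr_gt0 invr_lt0.
have sV (y : R) : - (- y^-1)^-1 = y by rewrite invrN opprK invrK.
have indexE (y mT : R) : y < 0 -> y < mT ->
    form_lower_bound dotp (opposite (inverse H1)) mT ->
    form_lower_bound dotp (opposite (inverse H2)) mT ->
  ((dimension (range (E1 `]-oo, 0%R[%classic)) + dimension (kernel_of H1))%E =
    ereal_sup [set (n%:R)%:E | n in negative_rel dotp H1 (- y^-1)]) *
  ((dimension (range (E2 `]-oo, 0%R[%classic)) + dimension (kernel_of H2))%E =
    ereal_sup [set (n%:R)%:E | n in negative_rel dotp H2 (- y^-1)]).
  move=> y0 ymT hT1 hT2; split.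
    by apply: (negative_index hilbertV sa1 sp1 (s0 _ y0) _ _ hT1); [rewrite sV|exists m].
  by apply: (negative_index hilbertV sa2 sp2 (s0 _ y0) _ _ hT2); [rewrite sV|exists m].
split=> [leT|eqi].
  have [y0 [mT [ymT hT1 hT2 hS]]] := relation_le_below hilbertV saT1 saT2 leT.
  (* The ordering holds at every point below [y0]; a negative one is needed for s = -1/y to be
     positive. *)
  pose y := Num.min y0 (-1).
  have yy0 : y <= y0 by rewrite ge_min lexx.
  have yn : y < 0 by rewrite gt_min ltrN10 orbT.
  have [S1 [S2 [hS1 hS2 S12]]] := hS y yy0.
  have hG1 := resolvent_of_opp_inverse sa1 yn hS1.
  have hG2 := resolvent_of_opp_inverse sa2 yn hS2.
  have yE := indexE y mT yn (le_lt_trans yy0 ymT) hT1 hT2; rewrite !yE.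
  congr (ereal_sup [set _ | n in _]); apply/seteqP; split=> n.
    apply: (negative_rel_resolvent_le sa1 sa2 hm1 hm2 xm' (xs _ yn)
      hR1 hR2 hG1 hG2) => h.
    by rewrite !ipE lerD2l ler_wpM2l// sqr_ge0.
  exact: (negative_rel_anti sa1 sa2 hm1 hm2 xm' (xs _ yn) hR1 hR2 R12).
have [C1 C10 hC1] := opp_inverse_bound hilbertV sa1 cr1.
have [C2 C20 hC2] := opp_inverse_bound hilbertV sa2 cr2.
(* A common form bound of both relations -H_j^-1; below it both resolvents exist and neither H_j has
   spectrum in ]0, -1/y]. *)
pose mT := - Num.max C1 C2; pose y := mT - 1.
have hT1 : form_lower_bound dotp (opposite (inverse H1)) mT.
  by apply: form_lower_bound_le hC1; rewrite lerN2 le_max lexx.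
have hT2 : form_lower_bound dotp (opposite (inverse H2)) mT.
  by apply: form_lower_bound_le hC2; rewrite lerN2 le_max lexx orbT.
have ymT : y < mT by rewrite gtrDl ltrN10.
have yn : y < 0 by rewrite (lt_trans ymT)// oppr_lt0 lt_max C10.
have [S1 hS1] := lower_bound_resolvent hilbertV saT1 hT1 ymT.
have [S2 hS2] := lower_bound_resolvent hilbertV saT2 hT2 ymT.
apply/(relation_leP hilbertV saT1 saT2); exists y, mT, S1, S2; split=> // h.
rewrite leNgt; apply/negP => S12.
have hG1 := resolvent_of_opp_inverse sa1 yn hS1.
have hG2 := resolvent_of_opp_inverse sa2 yn hS2.
have yE := indexE y mT yn ymT hT1 hT2.
rewrite yE in fin1; rewrite !yE in eqi.
have [n [_ e1 nmax]] := nat_sup_attained (negative_rel0 _ _ _) fin1.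
have fin2 := fin1; rewrite eqi in fin2.
have [n' [n'2 e2 _]] := nat_sup_attained (negative_rel0 _ _ _) fin2.
have nn' : n = n'.
  by apply/eqP; rewrite -(eqr_nat R) -eqe -e1 -e2 eqi.
(* A failure of the ordering at [h] enlarges a maximal negative family of [H2] to one of [H1] with
   one more vector, against the equality of the finite indices. *)
have : negative_rel dotp H1 (- y^-1) n.+1.
  rewrite nn'; apply: (negative_relS (v := h) sa1 sa2 hm1 hm2 xm' (xs _ yn)
    hR1 hR2 hG1 hG2 R12) => //.
  by rewrite !ipE ltrD2l ltr_pM2l// exprn_even_gt0//= (lt_eqF yn).
by move=> /nmax; rewrite ltnn.
Qed.
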